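(* Let $H$ be a finite, simple, connected graph with universal cover $\pi\colon T\to H$. Let $M$ be a bounded operator on $\ell^2(V(T))$ which is symmetric, local, connected and pulled back from $H$. The following are equivalent: (1) $M$ has a bounded inverse, and its Green function $G(x,y)=(M^{-1}\delta_x)(y)$ satisfies $G(u,u)\neq0$ for all $u\in V(T)$; (2) there is a finite ratio system $r$ for $M$ with $\alpha(r)<1$.
   Context: $E(H)$ is the set of directed edges, with $(u,v)^{-1}=(v,u)$. For directed edges, $e\to f$ means the head of $e$ is the tail of $f$ and $f\neq e^{-1}$. The universal cover $\pi\colon T\to H$ is a tree $T$ with a homomorphism $\pi$ restricting to a bijection between the edges at $x$ and the edges at $\pi(x)$, for every vertex $x$. For $M$ bounded on $\ell^2(V(T))$ let $M_{xy}=\langle\delta_x,M\delta_y\rangle$. We say $M$ is: - symmetric if $\overline{M}^*=M$; - local if $M_{xy}=0$ at distance $>1$; - connected if $M_{xy}\neq0$ at distance $1$; - pulled back if $M_{xy}$ depends only on $(\pi(x),\pi(y))$ when $x=y$ or $x\sim y$. Write $m_{ab}$ for this common value and $m_e=m_{ab}$ for $e=(a,b)\in E(H)$. A finite ratio system for $M$ is a function $r\colon E(H)\to\mathbb{C}\setminus\{0\}$ such that for every $e=(u,v)\in E(H)$: $$0=m_{vv}+\frac{m_{e^{-1}}}{r_e}+\sum_{e'\colon e\to e'}m_{e'}r_{e'}.$$ Its decay rate $\alpha(r)$ is the Perron eigenvalue (spectral radius) of the nonnegative matrix $R$ indexed by $E(H)$, with $R_{e,f}=|r_f|^2$ if $e\to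 f$ and $R_{e,f}=0$ otherwise.
   Formalization: The implication (2)⇒(1) is stated only when H is not a tree, since it fails for trees (H=K_2, all entries of M equal to 1, r=−1: α(r)=0 but M is singular); (1)⇒(2) is stated for every H. *)

(* Defs.v *)
From HB Require Import structures.
From mathcomp Require Import all_boot all_order all_algebra.
From mathcomp Require Import complex.
From mathcomp Require Import boolp classical_sets functions reals constructive_ereal.
From mathcomp Require Import fsbigop ereal esum.
From mathcomp Require Import ring.

Set Implicit Arguments.
Unset Strict Implicit.
Unset Printing Implicit Defensive.
Import Order.TTheory GRing.Theory Num.Theory.
Local Open Scope ring_scope.
Local Open Scope classical_set_scope.

Notation normc := ComplexField.Normc.normc.

Record sgraph (V : Type) := SGraph {
  adj :> rel V;
  adj_sym : symmetric adj;
  adj_irr : irreflexive adj }.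

Definition graph_connected (V : eqType) (e : sgraph V) :=
  (exists x : V, True) /\
  forall x y : V, exists2 p, path e x p & y = last x p.

(* [ucycle e c] allows the degenerate sequences [::] and [:: x; y]; the
   cycles of a simple graph are those of length at least 3. *)
Definition graph_acyclic (V : eqType) (e : sgraph V) :=
  forall c : seq V, ucycle e c -> (size c < 3)%N.

Definition is_tree (V : eqType) (e : sgraph V) :=
  graph_connected e /\ graph_acyclic e.

(* In a simple graph the edges at [x] are identified with the neighbours of
   [x]. *)
Record universal_cover (VT VH : eqType) (T : sgraph VT) (H : sgraph VH)
    (pi : VT -> VH) : Prop := UniversalCover {
  cover_tree : is_tree T;
  cover_hom : {homo pi : x y / T x y >-> H x y};
  cover_bij : forall x,
    set_bij [set y | T x y] [set b | H (pi x) b] pi }.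

Section DirectedEdges.
Variables (V : finType) (H : sgraph V).

Definition dedge : finType := {e : V * V | H e.1 e.2}.

Definition tail (e : dedge) : V := (val e).1.
Definition head (e : dedge) : V := (val e).2.

Lemma dinv_subproof (e : dedge) : H (head e, tail e).1 (head e, tail e).2.
Proof. by rewrite /= adj_sym; case: e. Qed.

Definition dinv (e : dedge) : dedge :=
  exist _ (head e, tail e) (dinv_subproof e).

Definition follows (e f : dedge) := (head e == tail f) && (f != dinv e).

End DirectedEdges.

Section L2.
Variables (R : realType) (V : choiceType).
Implicit Types f g : V -> R[i].

Definition sqnorm f : \bar R := \esum_(x in setT) (normc (f x) ^+ 2)%:E.

Definition l2_pred : {pred V -> R[i]} := fun f => `[< (sqnorm f < +oo)%E >].

Lemma normc_ge0 (z : R[i]) : 0 <= normc z.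
Proof. by case: z => a b; apply: sqrtr_ge0. Qed.

Lemma esum_scale_lty (c : R) (a : V -> R) : 0 <= c -> (forall x, 0 <= a x) ->
  (\esum_(x in setT) (a x)%:E < +oo)%E ->
  (\esum_(x in setT) (c * a x)%:E < +oo)%E.
Proof.
move=> c0 a0 afin.
apply: (@le_lt_trans _ _ (c%:E * \esum_(x in setT) (a x)%:E)%E); last first.
  by rewrite lte_mul_pinfty.
apply: ub_ereal_sup => _ [A [Afin _] <-].
under eq_fsbigr do rewrite EFinM.
rewrite -ge0_mule_fsumr; last by move=> x; rewrite lee_fin.
rewrite lee_wpmul2l ?lee_fin//.
by apply: ereal_sup_ubound; exists A.
Qed.

Lemma l2_submod_closed : submod_closed l2_pred.
Proof.
split.
  apply/asboolP; rewrite /sqnorm esum1 ?ltry// => x _.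
  by rewrite [X in normc X](_ : _ = 0)// ComplexField.Normc.normc0 expr0n.
move=> a f g /asboolP Hf /asboolP Hg; apply/asboolP.
pose c : R := 2 * normc a ^+ 2.
have c0 : 0 <= c by rewrite mulr_ge0// sqr_ge0.
apply: (@le_lt_trans _ _ (\esum_(x in setT)
  ((c * normc (f x) ^+ 2)%:E + (2 * normc (g x) ^+ 2)%:E)%E)).
  apply: le_esum => x _; rewrite -EFinD lee_fin.
  have -> : (a *: f + g)%R x = a * f x + g x by [].
  apply: (@le_trans _ _ ((normc (a * f x) + normc (g x)) ^+ 2)).
    by rewrite lerXn2r ?nnegrE ?addr_ge0 ?normc_ge0// le_normcD.
  rewrite ComplexField.Normc.normcM /c -mulrA -exprMn.
  set u := normc a * _; set v := normc (g x).
  rewrite -subr_ge0 [leRHS](_ : _ = (u - v) ^+ 2) ?sqr_ge0//.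
  by rewrite sqrrD sqrrB !mulr_natl !mulr2n; ring.
rewrite esumD; try by move=> x _; rewrite lee_fin mulr_ge0// sqr_ge0.
by rewrite lte_add_pinfty//; apply: esum_scale_lty => // x; rewrite sqr_ge0.
Qed.

HB.instance Definition _ := GRing.isSubmodClosed.Build _ _ l2_pred
  l2_submod_closed.

Record l2 := L2 { l2fun :> V -> R[i]; l2P : l2fun \in l2_pred }.

HB.instance Definition _ := [isSub for l2fun].
HB.instance Definition _ := [Choice of l2 by <:].
HB.instance Definition _ := [SubChoice_isSubLmodule of l2 by <:].

Definition l2norm (f : l2) : R := Num.sqrt (fine (sqnorm f)).

Lemma delta_subproof (x : V) :
  (fun y : V => (y == x)%:R : R[i]) \in l2_pred.
Proof.
apply/asboolP; rewrite /sqnorm (esumID [set x]); last first.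
  by move=> y _; rewrite lee_fin sqr_ge0.
rewrite setTI esum_set1 ?lee_fin ?sqr_ge0// esum1 ?adde0 ?ltry// => y [_ /=].
by move=> /eqP/negPf ->; rewrite ComplexField.Normc.normc0 expr0n.
Qed.

Definition delta (x : V) : l2 := L2 (delta_subproof x).

Lemma conj_subproof (f : l2) : (fun x => conjc (f x)) \in l2_pred.
Proof.
apply/asboolP; have /asboolP := l2P f; apply: le_lt_trans.
by apply: le_esum => x _ /=; case: (f x) => u v; rewrite /= sqrrN.
Qed.

Definition l2conj (f : l2) : l2 := L2 (conj_subproof f).

(* Sums of absolutely summable families, as the difference of the sums of the
   positive and negative parts; [csum] sums real and imaginary parts. *)
Definition rsum (a : V -> R) : R :=
  fine (\esum_(x in setT) (Num.max (a x) 0)%:E) -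
  fine (\esum_(x in setT) (Num.max (- a x) 0)%:E).

Definition csum (a : V -> R[i]) : R[i] :=
  Complex (rsum (fun x => complex.Re (a x))) (rsum (fun x => complex.Im (a x))).

Definition l2dot (f g : l2) : R[i] := csum (fun x => conjc (f x) * g x).

End L2.

Section Operators.
Variables (R : realType) (V : choiceType).
Local Notation l2 := (l2 R V).
Local Notation delta := (@delta R V).

Definition bounded_op (A : l2 -> l2) :=
  exists C : R, forall f, l2norm (A f) <= C * l2norm f.

Definition entry (A : l2 -> l2) (x y : V) : R[i] := l2dot (delta x) (A (delta y)).

(* [is_adjoint A B] says that [B] is the adjoint of [A]. *)
Definition is_adjoint (A B : l2 -> l2) :=
  forall f g, l2dot f (A g) = l2dot (B f) g.

Definition conj_op (A : l2 -> l2) : l2 -> l2 := fun f => l2conj (A (l2conj f)).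

Definition op_symmetric (A : l2 -> l2) := is_adjoint (conj_op A) A.

(* In a connected graph, being at distance 1 means being adjacent, and being
   at distance greater than 1 means being neither equal nor adjacent. *)
Definition op_local (T : sgraph V) (A : l2 -> l2) :=
  forall x y, x != y -> ~~ T x y -> entry A x y = 0.

Definition op_connected (T : sgraph V) (A : l2 -> l2) :=
  forall x y, T x y -> entry A x y != 0.

(* [m a b] is the common value of the entries above [(a, b)]. *)
Definition pulled_back (W : Type) (T : sgraph V) (pi : V -> W)
    (A : l2 -> l2) (m : W -> W -> R[i]) :=
  forall x y, (x == y) || T x y -> entry A x y = m (pi x) (pi y).

Definition bounded_inverse (A N : l2 -> l2) :=
  [/\ bounded_op N, cancel A N & cancel N A].

(* The Green function of the operator whose inverse is [N]. *)
Definition green (N : l2 -> l2) (x y : V) : R[i] := N (delta x) y.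

End Operators.

Section RatioSystems.
Variables (R : realType) (V : finType) (H : sgraph V) (m : V -> V -> R[i]).

Definition edge_value (e : dedge H) : R[i] := m (tail e) (head e).

Definition ratio_system (r : dedge H -> R[i]) :=
  (forall e, r e != 0) /\
  forall e, 0 = m (head e) (head e) + edge_value (dinv e) / r e
                + \sum_(f : dedge H | follows e f) edge_value f * r f.

Definition decay_matrix (r : dedge H -> R[i]) : 'M[R]_#|dedge H| :=
  \matrix_(i, j) (if follows (enum_val i) (enum_val j)
                  then normc (r (enum_val j)) ^+ 2 else 0).

(* Largest modulus of a complex eigenvalue; [0] for the empty matrix. *)
Definition spectral_radius (n : nat) (A : 'M[R]_n) : R :=
  sup [set normc z | z in
        [set z : R[i] | eigenvalue (map_mx (real_complex R) A) z]].

Definition decay_rate (r : dedge H -> R[i]) : R :=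
  spectral_radius (decay_matrix r).

End RatioSystems.

(* Main.v *)
(** An invertible [M] gives ratios [r (x, y) = G(x, y) / G(x, x)].  Cutting a row
    of the Green function [G] along an edge and applying [M] leaves two point
    masses at the ends of that edge; hence [G] is multiplicative along paths, does
    not vanish, and the ratios solve the ratio equations.  They descend to [H]
    because deck transformations commute with [M].  The tails of the rows in
    [l^2], normalised at the edge where they start, form a vector [w >= 1] with
    [1 + R w <= w] for the decay matrix [R], which bounds its spectral radius.

    Conversely, spectral radius [< 1] gives [w >= 1] with [w = 1 + R w].  The
    product [g_u] of the ratios along paths from [u] satisfies
    [M g_u = p(u) delta_u], and [p] either never vanishes or vanishes everywhere.
    In the latter case the ratios of inverse edges are inverse to each other, and
    [|r e|^2 w e / w (e^-1)] strictly decreases along non-backtracking walks, so [H]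
    has no cycle.  Otherwise [G(u, z) = g_u(z) / p(u)] is symmetric, and the
    weight [h], the product of [s |r|] with [s] slightly larger than 1 along paths
    from a root, satisfies [sum_z |G(x, z)| h(z) <= C h(x)]; by the Schur test [G]
    is bounded on [l^2]. *)

Require Import Defs.
From HB Require Import structures.
From mathcomp Require Import all_boot all_order all_algebra.
From mathcomp Require Import complex.
From mathcomp Require Import boolp classical_sets functions reals constructive_ereal.
From mathcomp Require Import fsbigop ereal esum.
From mathcomp Require Import ring lra.
From mathcomp Require polyrcf.
Import Defs.

Set Implicit Arguments.
Unset Strict Implicit.
Unset Printing Implicit Defensive.
Import Order.TTheory GRing.Theory Num.Theory.
Local Open Scope ring_scope.

(** * Paths in trees *)

Section TreePaths.
Variables (V : choiceType) (T : sgraph V).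
Hypothesis treeT : is_tree T.

(** Shortened to a simple path, the walk from [w] together with [y] would close up to a cycle of
    length at least 3 unless it is empty. *)
Lemma tree_neighbor_eq (y w : V) p : path T w p -> y \notin w :: p ->
  T y w -> T y (last w p) -> last w p = w.
Proof.
move=> pp yp yw yl; case: treeT => _ /(_ _) acyc.
move: pp yl yp; case/shortenP => p' pp' up' sub yl yp.
case: p' pp' up' sub yl => [//|b p'] pp' up' sub yl.
have yp' : y \notin w :: b :: p'.
  apply: contra yp; by rewrite !(in_cons w) => /orP[->//|/sub ->]; rewrite orbT.
suff /acyc : ucycle T (y :: w :: b :: p') by [].
rewrite /ucycle cons_uniq yp' up' /= andbT yw /=.
move: pp' => /= /andP[-> pb] /=.
by rewrite rcons_path pb adj_sym /=.
Qed.

Definition simple (x z : V) p := [&& path T x p, uniq (x :: p) & last x p == z].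

Lemma simple_exists x z : exists p, simple x z p.
Proof.
case: treeT => -[_ /(_ x z)[p pp ->]] _.
move: pp; case/shortenP => p' pp' up' _; exists p'.
by rewrite /simple pp' up' eqxx.
Qed.

Definition tpath x z := xchoose (simple_exists x z).

Lemma simple_tpath x z : simple x z (tpath x z).
Proof. exact: xchooseP. Qed.

(** One path followed by the reverse of the other joins the first steps [y] and [y'] while avoiding
    [x], so [tree_neighbor_eq] identifies them. *)
Lemma simple_inj x z p q : simple x z p -> simple x z q -> p = q.
Proof.
elim: p x q => [|y p IH] x [|y' q] //.
- move=> /and3P[_ _ /= /eqP->] /and3P[_ /= /andP[+ _] /eqP lz].
  by rewrite -lz mem_last.
- move=> /and3P[_ /= /andP[+ _] /eqP lz] /and3P[_ _ /= /eqP xz].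
  by rewrite xz -lz mem_last.
move=> /and3P[/= /andP[xy py] /andP[xp up] lp].
move=> /and3P[/= /andP[xy' py'] /andP[xq uq] lq].
suff yy : y' = y.
  subst y'; congr (_ :: _); apply: (IH y).
    by apply/and3P; split.
  by apply/and3P; split.
have lr : last (last y p) (rev (belast y' q)) = y'.
  rewrite (eqP lp) -(eqP lq); case: (q) => [//|a q'] /=.
  by rewrite rev_cons last_rcons.
rewrite -lr -last_cat; apply: (@tree_neighbor_eq x) => //.
- rewrite cat_path py /= (eqP lp) -(eqP lq) rev_path.
  by rewrite (eq_path (e' := T)) // => a b; rewrite adj_sym.
- rewrite -cat_cons mem_cat negb_or xp /= mem_rev.
  by apply: contra xq => /mem_belast.
- by rewrite last_cat lr.
Qed.

Lemma tpath_uniq x z p : simple x z p -> tpath x z = p.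
Proof. by apply: simple_inj; apply: simple_tpath. Qed.

Lemma tpath_id x : tpath x x = [::].
Proof. by apply: tpath_uniq; rewrite /simple /= eqxx. Qed.

Lemma tpath_nil x z : tpath x z = [::] -> z = x.
Proof. by move=> e; have := simple_tpath x z; rewrite e => /and3P[_ _ /eqP]. Qed.

Lemma tpath_cons x z y p : tpath x z = y :: p -> T x y /\ p = tpath y z.
Proof.
move=> e; have := simple_tpath x z; rewrite e.
move=> /and3P[/= /andP[xy py] /andP[xp up] lp]; split=> //.
by apply/esym/tpath_uniq/and3P.
Qed.

Lemma tpath_adj x y : T x y -> tpath x y = [:: y].
Proof.
move=> xy; apply: tpath_uniq; rewrite /simple /= xy eqxx !andbT inE.
by apply/eqP => e; rewrite e adj_irr in xy.
Qed.

(** Either [x] is off the path from [y] to [z] and extends it, or it lies on that path and, being a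
    neighbour of [y], can only be its first step. *)
Lemma tpath_step_first x y z : T x y ->
  tpath x z = y :: tpath y z \/ tpath y z = x :: tpath x z.
Proof.
move=> xy; have /and3P[py uy ly] := simple_tpath y z.
have [|xn] := boolP (x \in y :: tpath y z); last first.
  left; apply: tpath_uniq; apply/and3P; split=> //=; first by rewrite xy.
  by rewrite xn.
rewrite inE => /orP[/eqP e|]; first by rewrite e adj_irr in xy.
case tE : (tpath y z) => [//|w p] xp; right.
have [yw pE] := tpath_cons tE.
suff e : x = w by rewrite e pE.
move: xp; rewrite inE => /orP[/eqP//|xp].
rewrite tE in uy py; case/splitPr: xp pE uy py => p1 p2 pE uy py.
have l : last w (rcons p1 x) = x by rewrite last_rcons.
rewrite -l; apply: (@tree_neighbor_eq y).
- by move: py => /= /andP[_]; rewrite -cat_rcons cat_path => /andP[].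
- by move: uy; rewrite -cat_rcons cons_uniq -cat_cons mem_cat => /andP[/norP[]].
- by move: py => /= /andP[].
- by rewrite l adj_sym.
Qed.

Lemma tpath_step_last x y z : T y z ->
  tpath x z = rcons (tpath x y) z \/ tpath x y = rcons (tpath x z) y.
Proof.
move=> yz; have /and3P[py uy ly] := simple_tpath x y.
have [zp|zn] := boolP (z \in x :: tpath x y); last first.
  left; apply: tpath_uniq; apply/and3P; split.
  - by rewrite rcons_path py (eqP ly).
  - by rewrite -rcons_cons rcons_uniq zn.
  - by rewrite last_rcons.
right.
case/splitPl: zp uy py ly => p1 p2 l1; rewrite cat_path last_cat l1.
move=> up /andP[pp1 pp2] /eqP lp2.
have -> : tpath x z = p1.
  apply: tpath_uniq; apply/and3P; split => //; last exact/eqP.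
  by move: up; rewrite -cat_cons cat_uniq => /andP[].
suff -> : p2 = [:: y] by rewrite cats1.
have zyE : tpath z y = [:: y] by apply: tpath_adj; rewrite adj_sym.
rewrite -zyE; apply/esym/tpath_uniq; apply/and3P; split => //; last exact/eqP.
move: up; rewrite -cat_cons cat_uniq => /and3P[_ /hasPn h u2].
rewrite cons_uniq u2.
rewrite andbT; apply/negP => /h /=.
by rewrite -l1 mem_last.
Qed.

(* The component of [y] in the forest obtained by removing the edge [x y]. *)
Definition side x y z := tpath x z == y :: tpath y z.

Lemma sideC x y z : T x y -> side y x z = ~~ side x y z.
Proof.
rewrite /side => xy; have [e|e] := tpath_step_first z xy; rewrite e.
  (* The two path equations together would make a path longer than itself by 2. *)
  rewrite eqxx /=; apply/negP => /eqP/(congr1 size)/=.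
  by move=> /eqP; rewrite -addn2 -[X in X == _]addn0 eqn_add2l.
rewrite eqxx /=; apply/esym/negP => /eqP/(congr1 size)/=.
by move=> /eqP; rewrite -addn2 -[X in X == _]addn0 eqn_add2l.
Qed.

Lemma side_adj x y z : side x y z -> T x y.
Proof. by move=> /eqP/tpath_cons[]. Qed.

Lemma side_head x y : T x y -> side x y y.
Proof. by move=> xy; rewrite /side tpath_adj// tpath_id. Qed.

Lemma side_tail x y : ~~ side x y x.
Proof. by rewrite /side tpath_id. Qed.

Lemma side_ex x z : z != x -> exists y, side x y z.
Proof.
case e : (tpath x z) => [|y p]; first by rewrite (tpath_nil e) eqxx.
by move=> _; exists y; rewrite /side e; case: (tpath_cons e) => _ ->.
Qed.

Lemma side_uniq x y y' z : side x y z -> side x y' z -> y = y'.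
Proof. by rewrite /side => /eqP -> /eqP[]. Qed.

Lemma side_sub x y w z : T x y -> w != x -> side y w z -> side x y z.
Proof.
move=> xy wx s; rewrite -[side _ _ _]negbK -sideC //.
by apply: contra wx => /(side_uniq s) ->.
Qed.

Lemma side_step x y z : side x y z -> z != y ->
  exists w, [/\ T y w, w != x & side y w z].
Proof.
move=> s zy; have [w sw] := side_ex zy; exists w; split=> //.
  exact: side_adj sw.
have xy := side_adj s.
by apply/eqP => e; move: s; rewrite -[side _ _ _]negbK -sideC // -e sw.
Qed.

(** The edge [x y] is the only one leaving its side, so cutting a function along it disturbs a local
    operator only at [x] and [y]. *)
Lemma side_cross x y z z' : T x y -> T z z' -> side x y z -> ~~ side x y z' ->
  z = y /\ z' = x.
Proof.
move=> xy zz' s s'.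
have nh p : tpath x z' = y :: p -> False.
  by move=> e; move/negP: s'; apply; rewrite /side e; case: (tpath_cons e) => _ ->.
move/eqP: s => s; have [e|e] := tpath_step_last x zz'.
  by rewrite s in e; case: (nh _ e).
case e' : (tpath x z') => [|a p].
  rewrite e' s in e; case: e => e _; split; [by rewrite e | exact: tpath_nil].
rewrite e' s in e; case: e => e _; rewrite -e in e'; by case: (nh _ e').
Qed.

Fixpoint nonbacktracking (x : V) p :=
  if p is y :: p' then
    (if p' is z :: _ then z != x else true) && nonbacktracking y p'
  else true.

Lemma uniq_nonbacktracking x p : uniq (x :: p) -> nonbacktracking x p.
Proof.
elim: p x => [//|y p IH] x /= /andP[xp /[dup] up /IH ->]; rewrite andbT.
case: p xp {IH up} => [//|z p]; rewrite !inE !negb_or => /and3P[_ + _].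
by rewrite eq_sym.
Qed.

(** By induction the tail is simple. An immediate return to [x] is excluded; a later one arrives
    through a neighbour of [x], which is [y] by [tree_neighbor_eq], so that [y] would occur
    twice. *)
Lemma nonbacktracking_uniq x p :
  path T x p -> nonbacktracking x p -> uniq (x :: p).
Proof.
elim: p x => [//|y p IH] x /[dup] pxy /= /andP[xy pp] /andP[h nb].
have up := IH _ pp nb; rewrite -/(uniq (y :: p)) up andbT.
rewrite inE negb_or; apply/andP; split.
  by apply: contraL xy => /eqP ->; rewrite adj_irr.
apply/negP => xp; case/splitPr: xp pp up h {nb IH pxy} => p1 p2 pp up h.
case: p1 pp up h => [|z p1] pp up h; first by rewrite /= eqxx in h.
have := @tree_neighbor_eq x y (z :: p1); rewrite /= => K.
move: pp; rewrite cat_path => /andP[pp1 /= /andP[lx _]].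
have e : last z p1 = y.
  apply: K => //; last by rewrite adj_sym.
  move: up; rewrite -!cat_cons cat_uniq => /and3P[_ /hasPn/(_ x) + _].
  by rewrite !inE eqxx; apply.
by move: up; rewrite cons_uniq mem_cat -{1}e mem_last.
Qed.

Lemma tpath_rev x z : tpath z x = rev (belast x (tpath x z)).
Proof.
have /and3P[px ux /eqP lx] := simple_tpath x z.
apply: tpath_uniq; apply/and3P; split.
- by rewrite -[X in path _ X]lx rev_path (eq_path (e' := T)) // => a b; rewrite adj_sym.
- by rewrite -[X in X :: _]lx -rev_rcons -lastI rev_uniq.
- case: (tpath x z) lx => [/= ->//|a q] _ /=.
  by rewrite rev_cons last_rcons.
Qed.

Lemma size_tpathC x z : size (tpath z x) = size (tpath x z).
Proof. by rewrite tpath_rev size_rev size_belast. Qed.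

(** * Products along tree paths *)

Section PathProduct.
Variables (S : comPzRingType) (q : V -> V -> S).

Fixpoint wprod (x : V) p : S :=
  if p is y :: p' then q x y * wprod y p' else 1.

Lemma wprod_rcons x p y : wprod x (rcons p y) = wprod x p * q (last x p) y.
Proof. by elim: p x => [|z p IH] x /=; rewrite ?mulr1 ?mul1r // IH mulrA. Qed.

Definition gprod x z := wprod x (tpath x z).

Lemma gprod_id x : gprod x x = 1.
Proof. by rewrite /gprod tpath_id. Qed.

Lemma gprod_first x y z : side x y z -> gprod x z = q x y * gprod y z.
Proof. by rewrite /gprod => /eqP ->. Qed.

Lemma gprod_last x y z : side z y x -> gprod x z = gprod x y * q y z.
Proof.
move=> s; have zy := side_adj s.
have yz : T y z by rewrite adj_sym.
have [e|e] := tpath_step_last x yz.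
  rewrite /gprod e wprod_rcons; congr (_ * q _ _).
  by have /and3P[_ _ /eqP] := simple_tpath x y.
move/eqP/(congr1 size): s; move/(congr1 size): e.
rewrite size_rcons (size_tpathC x z) /= (size_tpathC x y) => ->.
by move=> /eqP; rewrite -[X in X == _]addn0 -addn2 eqn_add2l.
Qed.

End PathProduct.
End TreePaths.

(** * Universal covers *)

Section Cover.
Variables (VH : finType) (VT : choiceType) (H : sgraph VH) (T : sgraph VT).
Variable pi : VT -> VH.
Hypothesis coverT : universal_cover T H pi.

Let treeT := cover_tree coverT.

(* Over a non-neighbour [b] of [pi x] the value is the junk [x]. *)
Definition clift x b := xget x [set y | T x y /\ pi y = b]%classic.

Lemma cliftP x b : H (pi x) b -> T x (clift x b) /\ pi (clift x b) = b.
Proof.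
move=> ab; have [_ _ /(_ b ab)[y xy yb]] := cover_bij coverT x.
by apply: (@xgetPex _ x [set y | T x y /\ pi y = b]%classic); exists y.
Qed.

Lemma clift_adj x b : H (pi x) b -> T x (clift x b).
Proof. by move/cliftP => []. Qed.

Lemma pi_clift x b : H (pi x) b -> pi (clift x b) = b.
Proof. by move/cliftP => []. Qed.

Lemma clift_pi x y : T x y -> clift x (pi y) = y.
Proof.
move=> xy; have [_ inj _] := cover_bij coverT x.
have hxy := cover_hom coverT xy; have [? ?] := cliftP hxy.
by apply: inj => //; rewrite inE.
Qed.

Lemma cover_surj : graph_connected H -> forall a, exists x, pi x = a.
Proof.
move=> [_ connH] a; have [[[x0 _] _] _] := treeT.
have [p pp ->] := connH (pi x0) a.
elim: p x0 pp => [|b p IH] x /=; first by exists x.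
by move=> /andP[/cliftP[xy <-]] /IH.
Qed.

Lemma cover_edge_surj : graph_connected H -> forall a b, H a b ->
  exists x y, [/\ T x y, pi x = a & pi y = b].
Proof.
move=> /cover_surj surj a b; have [x <-] := surj a.
by move=> /cliftP[? ?]; exists x, (clift x b).
Qed.

(** A fold [phi w = phi z] over [y] would give [pi w = pi z], while [pi] is injective on the
    neighbours of [y]. *)
Lemma nonbacktracking_map (phi : VT -> VT) z p :
  (forall u v, T u v -> T (phi u) (phi v)) ->
  (forall u, pi (phi u) = pi u) ->
  path T z p -> nonbacktracking z p -> nonbacktracking (phi z) (map phi p).
Proof.
move=> hom hpi; elim: p z => [//|y p IH] z /= /andP[zy pp] /andP[h nb].
rewrite {}IH // andbT; case: p pp h nb => [//|w p] /= /andP[yw _] wz _.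
apply: contra wz => /eqP e; rewrite -(clift_pi yw) -(hpi w) e hpi.
by rewrite clift_pi // adj_sym.
Qed.

(** [phi z] is the endpoint of the lift, from [x'], of the projected path from [x] to [z]. It is
    injective because it sends simple paths to non-backtracking, hence simple, ones. *)
Lemma deck_exists x x' : pi x = pi x' ->
  exists phi : VT -> VT, [/\ injective phi, phi x = x',
    (forall z, pi (phi z) = pi z) & forall z y, T z y -> T (phi z) (phi y)].
Proof.
move=> xx'; pose phi z := foldl clift x' (map pi (tpath treeT x z)).
have pi_foldl p : path T x p -> pi (foldl clift x' (map pi p)) = pi (last x p).
  elim/last_ind: p => [_|p y IH]; first by rewrite /= xx'.
  rewrite rcons_path => /andP[/IH e /(cover_hom coverT) ly].
  by rewrite map_rcons foldl_rcons last_rcons pi_clift // e.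
have piphi z : pi (phi z) = pi z.
  have /and3P[px _ /eqP {2}<-] := simple_tpath treeT x z; exact: pi_foldl.
have phistep z y : T z y -> tpath treeT x y = rcons (tpath treeT x z) y ->
    T (phi z) (phi y).
  move=> zy e; rewrite /phi e map_rcons foldl_rcons -/(phi z).
  by apply: clift_adj; rewrite piphi (cover_hom coverT).
have hom z y : T z y -> T (phi z) (phi y).
  move=> zy; have [e|e] := tpath_step_last treeT x zy; first exact: phistep.
  by rewrite adj_sym; apply: phistep => //; rewrite adj_sym.
exists phi; split=> //; last by rewrite /phi tpath_id.
move=> z y e; have /and3P[pz uz lz] := simple_tpath treeT z y.
have : uniq (phi z :: map phi (tpath treeT z y)).
  apply: (nonbacktracking_uniq treeT).
    by rewrite path_map; apply: sub_path pz => ? ? /=; apply: hom.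
  by apply: nonbacktracking_map => //; apply: uniq_nonbacktracking.
case pE : (tpath treeT z y) => [|a p]; first by rewrite (tpath_nil pE).
rewrite cons_uniq; case/andP => + _.
by rewrite e -[X in phi X](eqP lz) -last_map pE /= mem_last.
Qed.

End Cover.

(** * Functions on directed edges *)

Section EdgeFunctions.
Variables (V : finType) (H : sgraph V).

Definition mkdedge a b (ab : H a b) : dedge H := exist _ (a, b) ab.

Lemma dedge_ind_pair (P : dedge H -> Prop) :
  (forall a b (ab : H a b), P (mkdedge ab)) -> forall e, P e.
Proof. by move=> h [[a b] ab]; apply: (h a b ab). Qed.

Lemma follows_mk a b b' c (ab : H a b) (bc : H b' c) :
  follows (mkdedge ab) (mkdedge bc) = (b == b') && (c != a).
Proof.
rewrite /follows {1}/tail {1}/head /=; apply: andb_id2l => /eqP e.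
by congr (~~ _); rewrite -val_eqE /= /head /tail /= xpair_eqE e eqxx.
Qed.

(** Extending edge functions to all pairs of vertices spares carrying adjacency proofs inside sums;
    [d] is a placeholder off the edges. *)
Definition pairfun (S : Type) (d : S) (r : dedge H -> S) a b : S :=
  if insub (a, b) is Some e then r e else d.

Lemma pairfunE (S : Type) (d : S) (r : dedge H -> S) a b (ab : H a b) :
  pairfun d r a b = r (mkdedge ab).
Proof. by rewrite /pairfun insubT. Qed.

Lemma sum_follows (S : nmodType) (F : V -> V -> S) (e : dedge H) :
  \sum_(f : dedge H | follows e f) F (tail f) (head f) =
  \sum_(b | H (head e) b && (b != tail e)) F (head e) b.
Proof.
elim/dedge_ind_pair: e => a b ab.
change (\sum_(f : dedge H | follows (mkdedge ab) f) F (tail f) (head f) =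
  \sum_(c | H b c && (c != a)) F b c).
rewrite (partition_big (@head V H) (fun c => H b c && (c != a))) /=; last first.
  elim/dedge_ind_pair => b' c bc; rewrite follows_mk.
  by rewrite /head /= => /andP[/eqP -> ->]; rewrite bc.
apply: eq_bigr => c /andP[bc ca]; rewrite (big_pred1 (mkdedge bc)) //.
elim/dedge_ind_pair => b' c' bc'; rewrite follows_mk /=.
rewrite -val_eqE /= xpair_eqE [RHS]andbC /head /=; have [->|] := eqVneq c' c.
  by rewrite ca /= !andbT eq_sym.
by rewrite andbF.
Qed.

(** On a cycle, the edge after one of minimal [Q] would have a smaller value still. *)
Lemma acyclic_decreasing d (S : orderType d) (Q : V -> V -> S) :
  (forall a b c, H a b -> H b c -> c != a -> (Q b c < Q a b)%O) ->
  graph_acyclic H.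
Proof.
move=> dec c /andP[cy uc]; rewrite ltnNge; apply/negP => sc.
(* Here length at least 3 matters: on a cycle of length 2 the second successor of [x] is [x]. *)
have nn x : x \in c -> next c (next c x) != x.
  move=> /rot_to[i p rE].
  rewrite -(next_rot i uc x) -(next_rot i uc) rE.
  have : uniq (x :: p) by rewrite -rE rot_uniq.
  have : (2 < size (x :: p))%N by rewrite -rE size_rot.
  case: p {rE} => [//|y [//|z p]] _ /=.
  rewrite !inE !negb_or eqxx => /andP[/and3P[xy xz xp] /andP[/andP[yz yp] _]].
  by rewrite eqxx (eq_sym y x) (negPf xy) (eq_sym z).
have [x0 x0c] : exists x, x \in c.
  by case: (c) sc => [//|x p] _; exists x; rewrite mem_head.
have [x xc xmin] := @arg_minP _ _ _ x0 (mem c) (fun x => Q x (next c x)) x0c.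
have /xmin : next c x \in c by rewrite mem_next.
apply/negP; rewrite -ltNge; apply: dec; last exact: nn.
  exact: next_cycle cy _.
by apply: next_cycle cy _; rewrite mem_next.
Qed.

End EdgeFunctions.

(** * Square-summable functions *)

Section Summable.
Variables (R : realType) (V : choiceType).
Implicit Types (a b u v : V -> R) (F : seq V).

Lemma esum_le_seq a (C : R) : (forall F, uniq F -> \sum_(x <- F) a x <= C) ->
  (\esum_(x in setT) (a x)%:E <= C%:E)%E.
Proof.
move=> h; apply: ge_ereal_sup => _ [A [Afin _] <-].
rewrite fsbig_finite // sumEFin lee_fin; apply: h.
exact: finmap.fset_uniq.
Qed.

Lemma seq_le_esum a F : uniq F ->
  ((\sum_(x <- F) a x)%:E <= \esum_(x in setT) (a x)%:E)%E.
Proof.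
move=> uF; rewrite -sumEFin fsbig_seq //.
by apply: ereal_sup_ubound; exists [set` F]%classic.
Qed.

Definition summableR a := (\esum_(x in setT) (`|a x|)%:E < +oo)%E.
(** [fine] sends an infinite sum to 0, so for a nonnegative family this is the true sum only under
    summability. *)
Definition psum a : R := fine (\esum_(x in setT) (a x)%:E).

Lemma psum_fin u : (forall x, 0 <= u x) -> summableR u ->
  (\esum_(x in setT) (u x)%:E = (psum u)%:E)%E.
Proof.
move=> u0 su; rewrite /psum fineK // ge0_fin_numE.
  apply: le_lt_trans su; apply: le_esum => x _; rewrite lee_fin; exact: ler_norm.
by apply: esum_ge0 => x _; rewrite lee_fin.
Qed.

Lemma psum_ge0 u : (forall x, 0 <= u x) -> 0 <= psum u.
Proof. by move=> u0; apply/fine_ge0/esum_ge0 => x _; rewrite lee_fin. Qed.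

Lemma summableR_le u v : (forall x, `|u x| <= `|v x|) -> summableR v -> summableR u.
Proof.
by move=> uv; apply: le_lt_trans; apply: le_esum => x _; rewrite lee_fin.
Qed.

Lemma summableR_seq u (C : R) : (forall x, 0 <= u x) ->
  (forall F, uniq F -> \sum_(x <- F) u x <= C) -> summableR u /\ psum u <= C.
Proof.
move=> u0 h; have hC := esum_le_seq h.
have su : summableR u.
  rewrite /summableR; under eq_esum do rewrite ger0_norm //.
  exact: le_lt_trans hC (ltry _).
by split=> //; rewrite -lee_fin -psum_fin.
Qed.

Lemma seq_le_psum u F : (forall x, 0 <= u x) -> summableR u -> uniq F ->
  \sum_(x <- F) u x <= psum u.
Proof. by move=> u0 su uF; rewrite -lee_fin -psum_fin //; apply: seq_le_esum. Qed.

Lemma psum_le u v : (forall x, 0 <= u x) -> (forall x, u x <= v x) ->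
  summableR v -> psum u <= psum v.
Proof.
move=> u0 uv sv; have v0 x : 0 <= v x by apply: le_trans (uv x).
have su : summableR u.
  by apply: summableR_le sv => x; rewrite !ger0_norm.
by rewrite -lee_fin -!psum_fin //; apply: le_esum => x _; rewrite lee_fin.
Qed.

Lemma summableRD a b : summableR a -> summableR b -> summableR (fun x => a x + b x).
Proof.
move=> sa sb; apply: le_lt_trans (lte_add_pinfty sa sb).
rewrite -esumD; try by move=> x _; rewrite lee_fin.
by apply: le_esum => x _; rewrite -EFinD lee_fin; apply: ler_normD.
Qed.

Lemma summableRZ k a : summableR a -> summableR (fun x => k * a x).
Proof.
move=> sa; rewrite /summableR.
under eq_esum do rewrite normrM.
exact: esum_scale_lty.
Qed.

Lemma psumD u v : (forall x, 0 <= u x) -> (forall x, 0 <= v x) ->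
  summableR u -> summableR v -> psum (fun x => u x + v x) = psum u + psum v.
Proof.
move=> u0 v0 su sv; apply: EFin_inj; rewrite EFinD -!psum_fin //.
- by rewrite -esumD //; try by move=> x _; rewrite lee_fin.
- by move=> x; apply: addr_ge0.
- exact: summableRD.
Qed.

Lemma psumZ k u : 0 <= k -> (forall x, 0 <= u x) -> summableR u ->
  psum (fun x => k * u x) = k * psum u.
Proof.
(* Used for [k] and then for [k^-1], this one-sided bound gives equality. *)
have le c w : 0 <= c -> (forall x, 0 <= w x) -> summableR w ->
    psum (fun x => c * w x) <= c * psum w.
  move=> c0 w0 sw; apply: (summableR_seq _ _).2 => [x|F uF]; first exact: mulr_ge0.
  by rewrite -mulr_sumr ler_wpM2l // seq_le_psum.
move=> k0 u0 su; apply/eqP; rewrite eq_le le //=.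
have [->|kn0] := eqVneq k 0.
  by rewrite mul0r; apply: psum_ge0 => x; rewrite mul0r.
have kp : 0 < k by rewrite lt_neqAle eq_sym kn0.
rewrite -(ler_pM2l (x := k^-1)) ?invr_gt0 // mulrA mulVf // mul1r.
apply: le_trans (le _ _ _ _ _).
- by apply: psum_le => // [x|]; rewrite ?mulrA ?mulVf ?mul1r //;
    apply: summableRZ; apply: summableRZ.
- by rewrite invr_ge0.
- by move=> x; apply: mulr_ge0.
- exact: summableRZ.
Qed.

Let pos a x := Num.max (a x) 0.
Let neg a x := Num.max (- a x) 0.

Let pos_ge0 a x : 0 <= pos a x.
Proof. by rewrite /pos le_max lexx orbT. Qed.
Let neg_ge0 a x : 0 <= neg a x.
Proof. by rewrite /neg le_max lexx orbT. Qed.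
Let posBneg a x : a x = pos a x - neg a x.
Proof. rewrite /pos /neg; case: (leP (a x) 0); case: (leP (- a x) 0); lra. Qed.
Let pos_le a x : pos a x <= `|a x|.
Proof. by rewrite /pos ge_max ler_norm normr_ge0. Qed.
Let neg_le a x : neg a x <= `|a x|.
Proof. by rewrite /neg ge_max normr_ge0 -normrN ler_norm. Qed.
Let spos a : summableR a -> summableR (pos a).
Proof. by apply: summableR_le => x; rewrite ger0_norm. Qed.
Let sneg a : summableR a -> summableR (neg a).
Proof. by apply: summableR_le => x; rewrite ger0_norm. Qed.

Lemma rsumE a : rsum a = psum (pos a) - psum (neg a).
Proof. by []. Qed.

(** Pointwise [pos a + v = neg a + u], and nonnegative sums add. Linearity of [rsum] rests on this
    freedom to use parts other than the canonical ones. *)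
Lemma rsum_split a u v : (forall x, 0 <= u x) -> (forall x, 0 <= v x) ->
  summableR u -> summableR v -> (forall x, a x = u x - v x) ->
  rsum a = psum u - psum v.
Proof.
move=> u0 v0 su sv e.
have sa : summableR a.
  have -> : a = (fun x => u x + (-1) * v x).
    by apply/funext => x; rewrite e mulN1r.
  by apply: summableRD => //; apply: summableRZ.
have h : psum (pos a) + psum v = psum (neg a) + psum u.
  rewrite -!psumD //; try exact: spos; try exact: sneg.
  congr psum; apply/funext => x.
  by have := posBneg a x; rewrite e; lra.
by rewrite rsumE; lra.
Qed.

Lemma rsumD a b : summableR a -> summableR b ->
  rsum (fun x => a x + b x) = rsum a + rsum b.
Proof.
move=> sa sb.
rewrite (@rsum_split _ (fun x => pos a x + pos b x) (fun x => neg a x + neg b x)).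
- by rewrite !psumD ?rsumE //; [ring|exact: sneg|exact: sneg|exact: spos|exact: spos].
- by move=> x; apply: addr_ge0.
- by move=> x; apply: addr_ge0.
- by apply: summableRD; exact: spos.
- by apply: summableRD; exact: sneg.
- by move=> x; rewrite {1}(posBneg a x) {1}(posBneg b x); ring.
Qed.

Lemma rsumN a : rsum (fun x => - a x) = - rsum a.
Proof.
rewrite !rsumE opprB; congr (psum _ - _).
by congr psum; rewrite /neg /pos funeqE => x; rewrite opprK.
Qed.

Lemma rsumZ k a : summableR a -> rsum (fun x => k * a x) = k * rsum a.
Proof.
move=> sa.
have pos_case c : 0 <= c -> rsum (fun x => c * a x) = c * rsum a.
  move=> c0; rewrite (@rsum_split _ (fun x => c * pos a x) (fun x => c * neg a x)).
  - by rewrite !psumZ ?rsumE ?mulrBr //; [exact: sneg|exact: spos].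
  - by move=> x; apply: mulr_ge0.
  - by move=> x; apply: mulr_ge0.
  - by apply: summableRZ; exact: spos.
  - by apply: summableRZ; exact: sneg.
  - by move=> x; rewrite {1}(posBneg a x); ring.
have [k0|k0] := leP 0 k; first exact: pos_case.
have -> : (fun x => k * a x) = (fun x => - (- k * a x)).
  by apply/funext => x; rewrite mulNr opprK.
by rewrite rsumN pos_case ?oppr_ge0 ?ltW // mulNr opprK.
Qed.

Lemma rsum_norm_le a : summableR a -> `|rsum a| <= psum (fun x => `|a x|).
Proof.
move=> sa; rewrite rsumE.
have san : summableR (fun x => `|a x|).
  by apply: summableR_le sa => x; rewrite normr_id.
have p0 := psum_ge0 (pos_ge0 a); have n0 := psum_ge0 (neg_ge0 a).
have p1 : psum (pos a) <= psum (fun x => `|a x|) by exact: psum_le.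
have n1 : psum (neg a) <= psum (fun x => `|a x|) by exact: psum_le.
by rewrite ler_norml; apply/andP; split; lra.
Qed.

Lemma psum_single u x : 0 <= u x -> (forall y, y != x -> u y = 0) -> psum u = u x.
Proof.
move=> u0 h; have u0' y : 0 <= u y by have [->|/h ->] := eqVneq y x.
rewrite /psum (esumID [set x]%classic); last by move=> y _; rewrite lee_fin.
rewrite setTI esum_set1 ?lee_fin // esum1 ?adde0 // => y [_ /= /eqP yx].
by rewrite h.
Qed.

Lemma rsum_single a x : (forall y, y != x -> a y = 0) -> rsum a = a x.
Proof.
move=> h; rewrite rsumE (@psum_single _ x) ?(@psum_single _ x) -?posBneg //.
  by move=> y /h yx; rewrite /neg yx oppr0 maxxx.
by move=> y /h yx; rewrite /pos yx maxxx.
Qed.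

End Summable.

(** * Sums of complex families *)

Section ComplexSums.
Variables (R : realType) (V : choiceType).
Implicit Types (f g : V -> R[i]).

Lemma normc_sqr (z : R[i]) : normc z ^+ 2 = complex.Re z ^+ 2 + complex.Im z ^+ 2.
Proof. by case: z => a b /=; rewrite sqr_sqrtr // addr_ge0 ?sqr_ge0. Qed.

Lemma normr_Re_le (z : R[i]) : `|complex.Re z| <= normc z.
Proof.
rewrite -(ler_pXn2r (n := 2)) ?nnegrE ?normc_ge0 // normc_sqr real_normK ?num_real //.
by rewrite lerDl sqr_ge0.
Qed.

Lemma normr_Im_le (z : R[i]) : `|complex.Im z| <= normc z.
Proof.
rewrite -(ler_pXn2r (n := 2)) ?nnegrE ?normc_ge0 // normc_sqr real_normK ?num_real //.
by rewrite lerDr sqr_ge0.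
Qed.

Lemma normc_le_ReIm (z : R[i]) : normc z <= `|complex.Re z| + `|complex.Im z|.
Proof.
rewrite -(ler_pXn2r (n := 2)) ?nnegrE ?normc_ge0 ?addr_ge0 //.
rewrite normc_sqr sqrrD !real_normK ?num_real // addrAC lerDl.
by rewrite mulrn_wge0 // mulr_ge0.
Qed.

Definition summableC f := summableR (fun x => normc (f x)).

Lemma summableC_Re f : summableC f -> summableR (fun x => complex.Re (f x)).
Proof.
by apply: summableR_le => x; rewrite (ger0_norm (normc_ge0 _)) normr_Re_le.
Qed.

Lemma summableC_Im f : summableC f -> summableR (fun x => complex.Im (f x)).
Proof.
by apply: summableR_le => x; rewrite (ger0_norm (normc_ge0 _)) normr_Im_le.
Qed.

Lemma csumD f g : summableC f -> summableC g ->
  csum (fun x => f x + g x) = csum f + csum g.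
Proof.
move=> sf sg.
have e1 : rsum (fun x => complex.Re (f x + g x)) =
    rsum (fun x => complex.Re (f x)) + rsum (fun x => complex.Re (g x)).
  rewrite -(rsumD (summableC_Re sf) (summableC_Re sg)); congr rsum.
  by apply/funext => x; case: (f x) (g x) => [? ?] [].
have e2 : rsum (fun x => complex.Im (f x + g x)) =
    rsum (fun x => complex.Im (f x)) + rsum (fun x => complex.Im (g x)).
  rewrite -(rsumD (summableC_Im sf) (summableC_Im sg)); congr rsum.
  by apply/funext => x; case: (f x) (g x) => [? ?] [].
by rewrite /csum e1 e2.
Qed.

Lemma csumZ (c : R[i]) f : summableC f -> csum (fun x => c * f x) = c * csum f.
Proof.
move=> sf; have sr := summableC_Re sf; have si := summableC_Im sf.
case: c => c d.
have e1 : rsum (fun x => complex.Re (Complex c d * f x)) =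
    c * rsum (fun x => complex.Re (f x)) - d * rsum (fun x => complex.Im (f x)).
  rewrite -mulNr -(rsumZ _ sr) -(rsumZ _ si).
  rewrite -(rsumD (summableRZ c sr) (summableRZ (- d) si)); congr rsum.
  by apply/funext => x; case: (f x) => a b /=; rewrite mulNr.
have e2 : rsum (fun x => complex.Im (Complex c d * f x)) =
    c * rsum (fun x => complex.Im (f x)) + d * rsum (fun x => complex.Re (f x)).
  rewrite -(rsumZ _ sr) -(rsumZ _ si).
  rewrite -(rsumD (summableRZ c si) (summableRZ d sr)); congr rsum.
  by apply/funext => x; case: (f x).
by rewrite /csum e1 e2.
Qed.

Lemma csum_single f x : (forall y, y != x -> f y = 0) -> csum f = f x.
Proof.
move=> h; rewrite /csum !(@rsum_single _ _ _ x); first by case: (f x).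
  by move=> y /h ->.
by move=> y /h ->.
Qed.

(** Real and imaginary parts are bounded separately, hence the factor 2. *)
Lemma normc_csum_le f : summableC f ->
  normc (csum f) <= 2 * psum (fun x => normc (f x)).
Proof.
move=> sf; apply: le_trans (normc_le_ReIm _) _ => /=.
have h1 := rsum_norm_le (summableC_Re sf).
have h2 := rsum_norm_le (summableC_Im sf).
rewrite mulr_natl mulr2n; apply: lerD.
  apply: le_trans h1 _; apply: psum_le => // x; exact: normr_Re_le.
apply: le_trans h2 _; apply: psum_le => // x; exact: normr_Im_le.
Qed.

End ComplexSums.

(** * The bilinear pairing on $\ell^2$ *)

Section Bilinear.
Variables (R : realType) (V : choiceType).
Local Notation l2 := (l2 R V).
Local Notation delta := (@delta R V).
Implicit Types (f g : l2) (F : seq V).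

Lemma sqnorm_summable f : summableR (fun x => normc (f x) ^+ 2).
Proof.
have /asboolP := l2P f; apply: le_lt_trans.
by apply: le_esum => x _; rewrite ger0_norm // sqr_ge0.
Qed.

Lemma sqnormE f : sqnorm f = (psum (fun x => normc (f x) ^+ 2))%:E.
Proof.
by rewrite /sqnorm psum_fin // => [x|]; [exact: sqr_ge0|exact: sqnorm_summable].
Qed.

Lemma l2norm_sqr f : l2norm f ^+ 2 = psum (fun x => normc (f x) ^+ 2).
Proof.
by rewrite /l2norm sqnormE /= sqr_sqrtr // psum_ge0 // => x; exact: sqr_ge0.
Qed.

Lemma l2norm_ge0 f : 0 <= l2norm f.
Proof. exact: sqrtr_ge0. Qed.

Lemma l2_predP (h : V -> R[i]) : summableR (fun x => normc (h x) ^+ 2) ->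
  h \in @l2_pred R V.
Proof.
move=> s; apply/asboolP; rewrite /sqnorm psum_fin ?ltry // => x; exact: sqr_ge0.
Qed.

Lemma l2_pred_le (h : V -> R[i]) f : (forall x, normc (h x) <= normc (f x)) ->
  h \in @l2_pred R V.
Proof.
move=> le; apply: l2_predP; apply: summableR_le (sqnorm_summable f) => x.
by rewrite !ger0_norm ?sqr_ge0 // lerXn2r // nnegrE normc_ge0.
Qed.

Lemma l2_ext f g : (forall x, f x = g x) -> f = g.
Proof. by move=> e; apply: val_inj; apply/funext. Qed.

(** Without conjugation, operators with $\overline{M}^*=M$ can be moved across this pairing
    unchanged. *)
Definition bil f g : R[i] := csum (fun x => f x * g x).

Lemma bil_summable f g : summableC (fun x => f x * g x).
Proof.
apply: summableR_le (summableRD (sqnorm_summable f) (sqnorm_summable g)) => x.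
rewrite ComplexField.Normc.normcM.
have := normc_ge0 (f x); have := normc_ge0 (g x).
move: (normc (f x)) (normc (g x)) => a b b0 a0.
rewrite !ger0_norm ?mulr_ge0 ?addr_ge0 ?sqr_ge0 //.
by have := sqr_ge0 (a - b); have := mulr_ge0 a0 b0; nra.
Qed.

Lemma bilC f g : bil f g = bil g f.
Proof. by rewrite /bil; congr csum; apply/funext => x; rewrite mulrC. Qed.

Lemma bilD f g h : bil (f + g) h = bil f h + bil g h.
Proof.
rewrite /bil -(csumD (bil_summable f h) (bil_summable g h)); congr csum.
by apply/funext => x; rewrite -mulrDl.
Qed.

Lemma bilZ c f h : bil (c *: f) h = c * bil f h.
Proof.
rewrite /bil -(csumZ c (bil_summable f h)); congr csum.
by apply/funext => x; rewrite mulrA.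
Qed.

Lemma bil0 h : bil 0 h = 0.
Proof. by rewrite -(scale0r 0) bilZ mul0r. Qed.

Lemma bil_sum (I : Type) (r : seq I) (P : pred I) (G : I -> l2) h :
  bil (\sum_(i <- r | P i) G i) h = \sum_(i <- r | P i) bil (G i) h.
Proof.
by elim/big_rec2: _ => [|i y1 y2 _ <-]; rewrite ?bil0 ?bilD.
Qed.

Lemma bil_delta x f : bil (delta x) f = f x.
Proof.
rewrite /bil (@csum_single _ _ _ x) /= ?eqxx ?mul1r // => y /negPf ->.
by rewrite mul0r.
Qed.

Lemma bilE f g : bil f g = l2dot (l2conj f) g.
Proof. by congr csum; apply/funext => x /=; rewrite conjcK. Qed.

Lemma l2conjK f : l2conj (l2conj f) = f.
Proof. by apply: l2_ext => x /=; rewrite conjcK. Qed.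

Lemma op_symmetric_bil (A : l2 -> l2) : op_symmetric A ->
  forall f g, bil f (A g) = bil (A f) g.
Proof. have bilJ f g : bil (l2conj f) (l2conj g) = conjc (bil f g).
  rewrite /bil /csum /= -rsumN; congr Complex; congr rsum.
    by apply/funext => x /=; case: (f x) (g x) => [? ?] [? ?] /=; rewrite mulrNN.
  apply/funext => x /=; case: (f x) (g x) => [? ?] [? ?] /=; ring.
move=> As f g; have := As f (l2conj g); rewrite /conj_op l2conjK => e.
by apply: (can_inj (@conjcK _)); rewrite -!bilJ !bilE !l2conjK. Qed.

Lemma l2conj_delta x : l2conj (delta x) = delta x.
Proof. by apply: l2_ext => y /=; rewrite conjc_nat. Qed.

Lemma entryE (A : l2 -> l2) x y : entry A x y = A (delta y) x.
Proof. by rewrite /entry -l2conj_delta -bilE bil_delta. Qed.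

Lemma l2_sumE (I : Type) (r : seq I) (P : pred I) (G : I -> l2) x :
  (\sum_(i <- r | P i) G i) x = \sum_(i <- r | P i) G i x.
Proof. by elim/big_rec2: _ => [//|i y1 y2 _ <-]. Qed.

Lemma deltaE x y : delta x y = (y == x)%:R. Proof. by []. Qed.
Lemma l2D f g x : (f + g) x = f x + g x. Proof. by []. Qed.
Lemma l2Z c f x : (c *: f) x = c * f x. Proof. by []. Qed.

Lemma sum_normc_le f F : uniq F ->
  \sum_(x <- F) normc (f x) ^+ 2 <= l2norm f ^+ 2.
Proof.
move=> uF; rewrite l2norm_sqr; apply: seq_le_psum => // [x|].
  exact: sqr_ge0.
exact: sqnorm_summable.
Qed.

End Bilinear.

(** * The spectral radius of a nonnegative matrix *)

Section Perron.
Variables (R : realType) (n : nat) (A : 'M[R]_n).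
Hypothesis A0 : forall i j, 0 <= A i j.

Lemma normc_sum_le (I : Type) (r : seq I) (P : pred I) (F : I -> R[i]) :
  normc (\sum_(i <- r | P i) F i) <= \sum_(i <- r | P i) normc (F i).
Proof.
elim/big_rec2: _ => [|i y x _ le]; first by rewrite ComplexField.Normc.normc0.
by apply: le_trans (le_normcD _ _) _; rewrite lerD2l.
Qed.

Lemma normc_real (x : R) : normc (real_complex R x) = `|x|.
Proof. by rewrite /= expr0n addr0 sqrtr_sqr. Qed.

Lemma normc_eq0 (z : R[i]) : (normc z == 0) = (z == 0).
Proof.
apply/eqP/eqP => [/ComplexField.Normc.eq0_normc//|->].
exact: ComplexField.Normc.normc0.
Qed.

(** Pair the moduli of a left eigenvector [v] with [w]:
    $|z|\sum|v_j|w_j\le\sum|v_i|A_{ij}w_j\le\rho\sum|v_i|w_i$, and the first sum is positive. *)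
Lemma eigenvalue_le_supersolution (w : 'I_n -> R) (rho : R) :
  (forall i, 0 < w i) -> (forall i, \sum_j A i j * w j <= rho * w i) ->
  forall z, eigenvalue (map_mx (real_complex R) A) z -> normc z <= rho.
Proof.
move=> w0 wA z /eigenvalueP[v vA v0].
have {}vA j : normc z * normc (v 0 j) <= \sum_i normc (v 0 i) * A i j.
  rewrite -ComplexField.Normc.normcM.
  have <- : (v *m map_mx (real_complex R) A) 0 j = z * v 0 j by rewrite vA mxE.
  rewrite mxE; apply: le_trans (normc_sum_le _ _ _) _.
  apply: ler_sum => i _.
  by rewrite ComplexField.Normc.normcM !mxE normc_real ger0_norm.
have s0 : 0 < \sum_j normc (v 0 j) * w j.
  have [i vi] : exists i, v 0 i != 0.
    apply: contrapT => h; move/negP: v0; apply; apply/eqP/rowP => i.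
    by rewrite mxE; apply: contrapT => /eqP vi; apply: h; exists i.
  rewrite (bigD1 i) //= ltr_wpDr ?sumr_ge0 //.
    by move=> j _; rewrite mulr_ge0 ?normc_ge0 // ltW.
  by rewrite mulr_gt0 // lt_neqAle eq_sym normc_eq0 vi normc_ge0.
rewrite -(ler_pM2r s0) mulr_sumr.
apply: (@le_trans _ _ (\sum_j (\sum_i normc (v 0 i) * A i j) * w j)).
  by apply: ler_sum => j _; rewrite mulrA ler_wpM2r // ltW.
under eq_bigr do rewrite mulr_suml.
rewrite exchange_big /= mulr_sumr; apply: ler_sum => i _.
under eq_bigr do rewrite -mulrA.
by rewrite -mulr_sumr mulrCA ler_wpM2l // normc_ge0.
Qed.

Lemma spectral_radius_le (w : 'I_n -> R) (rho : R) : 0 <= rho ->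
  (forall i, 0 < w i) -> (forall i, \sum_j A i j * w j <= rho * w i) ->
  spectral_radius A <= rho.
Proof.
move=> rho0 w0 wA; rewrite /spectral_radius; set S := (X in sup X).
(* The supremum of an empty set of moduli is 0, whence the assumption [0 <= rho]. *)
have [->|/set0P S0] := eqVneq S set0%classic; first by rewrite sup0.
apply: ge_sup => // _ [z ez <-]; exact: eigenvalue_le_supersolution ez.
Qed.

Lemma eigenvalue_le_radius z :
  eigenvalue (map_mx (real_complex R) A) z -> normc z <= spectral_radius A.
Proof.
move=> ez; apply: sup_upper_bound; last by exists z.
split; first by exists (normc z), z.
(* The supremum bounds the moduli only if they are bounded; the constant vector 1, with the total of
   all entries as [rho], provides a bound. *)
exists (\sum_i \sum_j A i j) => _ [y ey <-].
apply: (@eigenvalue_le_supersolution (fun=> 1)) ey => // i.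
rewrite mulr1 [leRHS](bigD1 i) //=; under eq_bigr do rewrite mulr1.
by rewrite lerDl sumr_ge0 // => j _; apply: sumr_ge0.
Qed.

Let d : {poly R} := char_poly A.
(* [p] is the numerator of the vector (x - A)^-1 1, by Cramer's rule. *)
Let p i : {poly R} := \sum_j (\adj (char_poly_mx A)) i j.

(** Row [i] of $(X-A)\,\mathrm{adj}(X-A)=d\,I$, summed over the columns and evaluated at [x]. *)
Let p_eq i x : x * (p i).[x] = d.[x] + \sum_j A i j * (p j).[x].
Proof.
have /(congr1 (fun M : 'M_n => \sum_k M i k)) := mul_mx_adj (char_poly_mx A).
rewrite (eq_bigr (fun k => \sum_j char_poly_mx A i j * (\adj (char_poly_mx A)) j k));
  last by move=> k _; rewrite mxE.
rewrite exchange_big /=.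
under eq_bigr do rewrite -mulr_sumr -/(p _).
rewrite [RHS](bigD1 i) //= [X in _ = _ + X]big1; last first.
  by move=> k /negPf ki; rewrite mxE eq_sym ki.
rewrite mxE eqxx mulr1n addr0 -/d.
under eq_bigr do rewrite !mxE mulrBl.
rewrite big_split /= (bigD1 i) //= big1; last first.
  by move=> k /negPf ki; rewrite eq_sym ki mul0r.
rewrite eqxx mulr1n addr0; move: (p) => q /(congr1 (fun u : {poly R} => u.[x])).
rewrite hornerD hornerM hornerX horner_sum => <-.
rewrite -addrA -big_split /= big1 ?addr0 // => j _.
by rewrite hornerN hornerM hornerC addNr.
Qed.

Hypothesis radius_lt1 : spectral_radius A < 1.

(** A root at least 1 would be an eigenvalue exceeding the spectral radius. Being monic, [d] is
    positive far out, and so on all of $[1,\infty)$ by the intermediate value theorem. *)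
Let d_gt0 x : 1 <= x -> 0 < d.[x].
Proof.
have nroot y : 1 <= y -> ~~ root d y.
  move=> y1; apply/negP => dy.
  have /eigenvalue_le_radius : eigenvalue (map_mx (real_complex R) A) (real_complex R y).
    by rewrite eigenvalue_root_char -map_char_poly rmorph_root.
  rewrite normc_real ger0_norm ?(le_trans _ y1) // => h.
  by have := lt_le_trans radius_lt1 y1; rewrite ltNge h.
move=> x1; rewrite ltNge; apply/negP => dx.
have [b hb] : exists n0, forall y : R, n0 <= y -> lead_coef d <= d.[y].
  by apply: polyrcf.poly_pinfty_gt_lc; rewrite (monicP (char_poly_monic A)).
have xb : x <= Num.max x b by rewrite le_max lexx.
have := hb (Num.max x b); rewrite le_max lexx orbT (monicP (char_poly_monic A)).
move=> /(_ isT) h.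
have [|y yx ry] := polyrcf.poly_ivt xb (p := d).
  by rewrite mulr_le0_ge0 // (le_trans ler01 h).
move: yx; rewrite in_itv /= => /andP[xy _].
by have := nroot y (le_trans x1 xy); rewrite ry.
Qed.

(** For the index [i] minimising [(p i).[x]], [p_eq] gives $(x-\sum_jA_{ij})\,p_i(x)\ge d(x)>0$, and
    [x] exceeds every row sum. *)
Let p_gt0_large : exists b : R, forall x, b <= x -> 1 <= x -> forall i, 0 < (p i).[x].
Proof.
exists (1 + \sum_i \sum_j A i j) => x xb x1 i0.
have [i _ imin] := @arg_minP _ _ _ i0 predT (fun i => (p i).[x]) isT.
apply: lt_le_trans (imin i0 isT); rewrite ltNge; apply/negP => pi0.
have := p_eq i x; have := d_gt0 x1.
have : (\sum_j A i j) * (p i).[x] <= \sum_j A i j * (p j).[x].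
  by rewrite mulr_suml; apply: ler_sum => j _; rewrite ler_wpM2l // imin.
have : \sum_j A i j <= \sum_i \sum_j A i j.
  rewrite [leRHS](bigD1 i) //= lerDl sumr_ge0 // => j _; exact: sumr_ge0.
have : 0 <= \sum_j A i j by exact: sumr_ge0.
nra.
Qed.

Let p_near i x e : 0 < e -> exists2 dl, 0 < dl &
  forall y, `|y - x| < dl -> `|(p i).[y] - (p i).[x]| < e.
Proof. exact: polyrcf.poly_cont. Qed.

(** Positivity descends from infinity to 1. At the supremum [x0] of the points where some [p j] is
    not positive, all are nonnegative by continuity, then positive by [p_eq] and [d_gt0], hence
    positive nearby: a contradiction. *)
Let p_gt0 i : 0 < (p i).[1].
Proof.
rewrite ltNge; apply/negP => pi1; have [b hb] := p_gt0_large.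
pose S := [set x : R | 1 <= x /\ exists j, (p j).[x] <= 0]%classic.
have S1 : S 1 by split=> //; exists i.
have Sub : has_sup S.
  split; first by exists 1.
  exists (Num.max b 1) => x [x1 [j pj]]; rewrite leNgt; apply/negP.
  rewrite gt_max => /andP[/ltW bx _].
  by have := hb x bx x1 j; rewrite ltNge pj.
pose x0 := sup S.
have x01 : 1 <= x0 by apply: sup_upper_bound Sub _ S1.
have after y j : x0 < y -> 0 < (p j).[y].
  move=> xy; rewrite ltNge; apply/negP => pj.
  have : y <= x0.
    by apply: (sup_upper_bound Sub); split; [lra|exists j].
  by rewrite leNgt xy.
have at_ge0 j : 0 <= (p j).[x0].
  rewrite leNgt; apply/negP => pj.
  have [|dl dl0 h] := @p_near j x0 (- (p j).[x0]); first by rewrite oppr_gt0.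
  have := h (x0 + dl / 2); rewrite addrAC subrr add0r ger0_norm; last by lra.
  have dl2 : dl / 2 < dl by lra.
  move=> /(_ dl2); have : 0 < (p j).[x0 + dl / 2] by apply: after; lra.
  by rewrite ltr_norml => ? /andP[_]; lra.
have at_gt0 j : 0 < (p j).[x0].
  have x0p : 0 < x0 by lra.
  rewrite -(pmulr_rgt0 _ x0p) p_eq ltr_wpDr ?d_gt0 // sumr_ge0 // => k _.
  exact: mulr_ge0.
have [e e0 he] : exists2 e, 0 < e & forall y j, `|y - x0| < e -> 0 < (p j).[y].
  have /choice[dl hdl] : forall j, exists dl, 0 < dl /\
      forall y, `|y - x0| < dl -> 0 < (p j).[y].
    move=> j; have [dl dl0 h] := @p_near j x0 _ (at_gt0 j).
    by exists dl; split=> // y /h; rewrite ltr_norml => /andP[]; lra.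
  exists (\big[Num.min/1]_j dl j).
    by elim/big_rec: _ => [|j y _ y0]; rewrite ?ltr01 // lt_min y0 (hdl j).1.
  move=> y j yx; apply: (hdl j).2; apply: lt_le_trans yx _.
  exact: bigmin_le_cond.
have [s [s1 [j pj]] sx] := sup_adherent e0 Sub.
have sx0 : s <= x0 by apply: (sup_upper_bound Sub); split=> //; exists j.
have : `|s - x0| < e by rewrite -/x0 in sx; rewrite ler0_norm; lra.
by move=> /(he s j); rewrite ltNge pj.
Qed.

(** The vector $(1-A)^{-1}\mathbf 1$, by Cramer's rule. *)
Lemma resolvent_supersolution :
  exists w : 'I_n -> R, forall i, 1 <= w i /\ w i = 1 + \sum_j A i j * w j.
Proof.
have d1 : 0 < d.[1] by exact: d_gt0.
exists (fun i => (p i).[1] / d.[1]) => i.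
have e : (p i).[1] / d.[1] = 1 + \sum_j A i j * ((p j).[1] / d.[1]).
  rewrite -[(p i).[1]]mul1r p_eq mulrDl divff ?gt_eqF //; congr (_ + _).
  by rewrite mulr_suml; apply: eq_bigr => j _; rewrite mulrA.
split=> //; rewrite e lerDl sumr_ge0 // => j _.
by rewrite mulr_ge0 // divr_ge0 //; apply: ltW => //; exact: p_gt0.
Qed.

End Perron.

(** * The decay rate of edge ratios *)

Section Decay.
Variables (R : realType) (V : finType) (H : sgraph V) (r : dedge H -> R[i]).

Lemma decay_matrix_ge0 i j : 0 <= decay_matrix r i j.
Proof. by rewrite mxE; case: ifP => // _; rewrite sqr_ge0. Qed.

Lemma decay_matrix_mul (w : dedge H -> R) i :
  \sum_j decay_matrix r i j * w (enum_val j) =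
  \sum_(f : dedge H | follows (enum_val i) f) normc (r f) ^+ 2 * w f.
Proof.
rewrite [RHS]big_mkcond (reindex (fun j : 'I_#|dedge H| => enum_val j)) /=.
  by apply: eq_bigr => j _; rewrite mxE; case: ifP => _; rewrite ?mul0r.
by exists enum_rank => ? _; rewrite ?enum_valK ?enum_rankK.
Qed.

(** As [w <= K], the hypothesis $1+Rw\le w$ yields $Rw\le w-1\le(1-1/K)w$. *)
Lemma decay_rate_lt1 (w : dedge H -> R) : (forall e, 0 <= w e) ->
  (forall e, 1 + \sum_(f : dedge H | follows e f) normc (r f) ^+ 2 * w f <= w e) ->
  decay_rate r < 1.
Proof.
move=> w0 wle; pose K := 1 + \sum_e w e.
have K1 : 1 <= K by rewrite lerDl sumr_ge0.
have Kp : 0 < K by apply: lt_le_trans K1.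
have w1 e : 1 <= w e.
  apply: le_trans (wle e); rewrite lerDl sumr_ge0 // => f _.
  by rewrite mulr_ge0 ?sqr_ge0.
have Ki : K^-1 <= 1 by rewrite invf_le1.
have Ki0 : 0 < K^-1 by rewrite invr_gt0.
apply: (@le_lt_trans _ _ (1 - K^-1)); last by lra.
apply: (@spectral_radius_le _ _ _ decay_matrix_ge0 (fun i => w (enum_val i))).
- by lra.
- by move=> i; apply: lt_le_trans (w1 _).
move=> i; rewrite decay_matrix_mul; set e := enum_val i.
have wK : K^-1 * w e <= 1.
  rewrite ler_pdivrMl // mulr1 /K (bigD1 e) //=.
  have : 0 <= \sum_(f | f != e) w f by apply: sumr_ge0.
  by lra.
by have := wle e; rewrite mulrBl mul1r; lra.
Qed.

Lemma decay_weight_exists : decay_rate r < 1 ->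
  exists w : dedge H -> R, forall e, 1 <= w e /\
    w e = 1 + \sum_(f : dedge H | follows e f) normc (r f) ^+ 2 * w f.
Proof.
move=> /(resolvent_supersolution decay_matrix_ge0)[w hw].
exists (fun e => w (enum_rank e)) => e; have [w1 we] := hw (enum_rank e).
split=> //; rewrite {1}we; congr (_ + _); rewrite -[e in RHS](enum_rankK e).
rewrite -(decay_matrix_mul (fun e => w (enum_rank e))).
by apply: eq_bigr => j _; rewrite enum_valK.
Qed.

End Decay.

(** * From the Green function to a ratio system *)

Section PsumSums.
Variables (R : realType) (V : choiceType).

Lemma psum_sum (I : Type) (s : seq I) (P : pred I) (u : I -> V -> R) :
  (forall i x, 0 <= u i x) -> (forall i, summableR (u i)) ->
  summableR (fun x => \sum_(i <- s | P i) u i x) /\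
  psum (fun x => \sum_(i <- s | P i) u i x) = \sum_(i <- s | P i) psum (u i).
Proof.
move=> u0 su; elim: s => [|i s [IHs IH]].
  rewrite big_nil; have -> : (fun x => \sum_(i <- [::] | P i) u i x) = fun=> 0.
    by apply/funext => x; rewrite big_nil.
  have s0 : summableR (fun _ : V => 0 : R).
    by rewrite /summableR esum1 // => x _; rewrite normr0.
  split=> //; rewrite /psum esum1 //.
rewrite big_cons; have -> : (fun x => \sum_(j <- i :: s | P j) u j x) =
    (fun x => (if P i then u i x else 0) + \sum_(j <- s | P j) u j x).
  by apply/funext => x; rewrite big_cons; case: ifP; rewrite ?add0r.
case: (P i).
  by split; [exact: summableRD|rewrite psumD ?IH // => x; apply: sumr_ge0].
have -> : (fun x => 0 + \sum_(j <- s | P j) u j x) =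
   (fun x => \sum_(j <- s | P j) u j x) by apply/funext => x; rewrite add0r.
by [].
Qed.

End PsumSums.

(** * The operator on the tree and its Green function *)

Section Operator.
Variables (R : realType) (VH : finType) (VT : choiceType).
Variables (H : sgraph VH) (T : sgraph VT) (pi : VT -> VH).
Variables (M : {linear l2 R VT -> l2 R VT}) (m : VH -> VH -> R[i]).
Hypotheses (Hconn : graph_connected H) (Hcover : universal_cover T H pi).
Hypotheses (Msym : op_symmetric M) (Mlocal : op_local T M).
Hypotheses (Mconn : op_connected T M) (Mpull : pulled_back T pi M m).
Local Notation l2 := (l2 R VT).
Local Notation delta := (@delta R VT).
Local Notation clift := (clift T pi).

Let treeT := cover_tree Hcover.
Let Mbil := op_symmetric_bil Msym.

Lemma op_entryC x y : M (delta x) y = M (delta y) x.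
Proof. by rewrite -(bil_delta y) Mbil bilC bil_delta. Qed.

Lemma op_entry_adj x y : T x y -> M (delta y) x = m (pi x) (pi y).
Proof. by move=> xy; rewrite -entryE Mpull // xy orbT. Qed.

Lemma op_entry_diag x : M (delta x) x = m (pi x) (pi x).
Proof. by rewrite -entryE Mpull // eqxx. Qed.

Lemma weightC a b : H a b -> m a b = m b a.
Proof.
move=> /(cover_edge_surj Hcover Hconn)[x [y [xy <- <-]]].
by rewrite -op_entry_adj // op_entryC op_entry_adj // adj_sym.
Qed.

Lemma weight_neq0 a b : H a b -> m a b != 0.
Proof.
move=> /(cover_edge_surj Hcover Hconn)[x [y [xy <- <-]]].
by rewrite -op_entry_adj // -entryE Mconn.
Qed.

(** Indexing the neighbours of [x] by those of [pi x] makes the sum finite; the formula also applies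
    to functions not known to lie in $\ell^2$. *)
Definition op_apply (f : VT -> R[i]) x : R[i] :=
  m (pi x) (pi x) * f x + \sum_(b | H (pi x) b) m (pi x) b * f (clift x b).

Lemma sum_lift_single (F : VH -> R[i]) c x y : T x y ->
  \sum_(b | H (pi x) b) F b * ((clift x b == y)%:R * c) = F (pi y) * c.
Proof.
move=> xy; have hxy := cover_hom Hcover xy.
rewrite (bigD1 (pi y)) //= (clift_pi Hcover xy) eqxx mul1r big1 ?addr0 //.
move=> b /andP[xb bp]; have [_ pb] := cliftP Hcover xb.
case: eqP => [e|_]; last by rewrite mul0r mulr0.
by rewrite -pb e eqxx in bp.
Qed.

(** Testing against [delta x] and moving [M] across the pairing leaves [M (delta x)], which is
    supported on [x] and its neighbours by locality. *)
Lemma opE (f : l2) x : M f x = op_apply f x.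
Proof.
have e : M (delta x) = m (pi x) (pi x) *: delta x +
    \sum_(b | H (pi x) b) m (pi x) b *: delta (clift x b).
  apply: l2_ext => y; rewrite l2D l2Z l2_sumE.
  have [->|yx] := eqVneq y x.
    rewrite op_entry_diag deltaE eqxx mulr1 big1 ?addr0 // => b xb.
    rewrite l2Z deltaE; case: eqP => [e|_]; last by rewrite mulr0.
    by have [] := cliftP Hcover xb; rewrite -e adj_irr.
  rewrite deltaE (negPf yx) mulr0 add0r.
  have [xy|nxy] := boolP (T x y).
    rewrite op_entryC op_entry_adj // -[LHS]mulr1.
    rewrite -(sum_lift_single (m (pi x)) 1 xy).
    by apply: eq_bigr => b _; rewrite l2Z deltaE mulr1 eq_sym.
  rewrite -entryE Mlocal ?big1 // 1?adj_sym // => b xb.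
  rewrite l2Z deltaE; case: eqP => [e|_]; last by rewrite mulr0.
  by move: nxy; rewrite e (clift_adj Hcover).
rewrite -bil_delta Mbil e bilD bilZ bil_delta bil_sum; congr (_ + _).
by apply: eq_bigr => b _; rewrite bilZ bil_delta.
Qed.

Section Inverse.
Variable N : {linear l2 -> l2}.
Hypotheses (MK : cancel M N) (NK : cancel N M).
Hypothesis green_neq0 : forall u, green N u u != 0.

Let G x z : R[i] := N (delta x) z.
Let G_diag x : G x x != 0. Proof. exact: green_neq0. Qed.
Local Notation tside := (side treeT).

Lemma op_apply_green u x : op_apply (G u) x = (x == u)%:R.
Proof. by rewrite -opE NK. Qed.

(* Cutting the Green function along the edge [x y] and applying [M] leaves only
   two point masses, at the ends of that edge. *)
Lemma green_cut x y u z : T x y -> ~~ tside x y u ->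
  (if tside x y z then G u z else 0) =
  m (pi x) (pi y) * (G u y * G x z - G u x * G y z).
Proof.
move=> xy su; set mu := m _ _.
have cutP : (fun z => if tside x y z then G u z else 0) \in @l2_pred R VT.
  apply: (@l2_pred_le _ _ _ (N (delta u))) => a; case: ifP => // _.
  by rewrite ComplexField.Normc.normc0 normc_ge0.
have [h hval] : exists h : l2, forall z, h z = if tside x y z then G u z else 0.
  by exists (L2 cutP).
have hxy := cover_hom Hcover xy.
suff Mh : M h = (mu * G u y) *: delta x + (- (mu * G u x)) *: delta y.
  have Nl c d : N (c *: delta x + d *: delta y) z = c * G x z + d * G y z.
    by rewrite linearD !linearZ.
  rewrite -hval -(MK h) Mh Nl.
  ring.
apply: l2_ext => a; rewrite opE l2D !l2Z !deltaE.
(* The cut-off agrees at [a] and at its neighbour unless they span the edge [x y]; the two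
   corrections belong to its two directions. *)
have hE b : H (pi a) b -> h (clift a b) = (tside x y a)%:R * G u (clift a b)
    + (clift a b == y)%:R * ((a == x)%:R * G u y)
    - (clift a b == x)%:R * ((a == y)%:R * G u x).
  move=> ab; have [ac _] := cliftP Hcover ab; move: (clift a b) ac => c ac.
  rewrite hval; have [sa|sa] := boolP (tside x y a).
    have [sc|sc] := boolP (tside x y c).
      have -> : (c == x) = false.
        by apply: contraTF sc => /eqP ->; exact: side_tail.
      have -> : (a == x) = false.
        by apply: contraTF sa => /eqP ->; exact: side_tail.
      by rewrite /=; ring.
    have [-> ->] := side_cross xy ac sa sc; rewrite !eqxx.
    have -> : (x == y) = false by apply: contraTF xy => /eqP ->; rewrite adj_irr.
    by rewrite /=; ring.
  have [sc|sc] := boolP (tside x y c).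
    have ca : T c a by rewrite adj_sym.
    have [-> ->] := side_cross xy ca sc sa; rewrite !eqxx.
    have -> : (y == x) = false.
      by apply: contraTF xy => /eqP ->; rewrite adj_irr.
    by rewrite /=; ring.
  have -> : (c == y) = false.
    by apply: contraNF sc => /eqP ->; exact: side_head.
  have -> : (a == y) = false.
    by apply: contraNF sa => /eqP ->; exact: side_head.
  by rewrite /=; ring.
have sumE : op_apply h a = (tside x y a)%:R * op_apply (G u) a
    + (a == x)%:R * (mu * G u y) - (a == y)%:R * (mu * G u x).
  rewrite /op_apply (eq_bigr _ (fun b ab => congr1 _ (hE b ab))).
  have -> : h a = (tside x y a)%:R * G u a.
    by rewrite hval; case: ifP => _; rewrite ?mul1r ?mul0r.
  rewrite (eq_bigr (fun b => (tside x y a)%:R * (m (pi a) b * G u (clift a b))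
    + m (pi a) b * ((clift a b == y)%:R * ((a == x)%:R * G u y))
    - m (pi a) b * ((clift a b == x)%:R * ((a == y)%:R * G u x)))); last first.
    by move=> b _; ring.
  rewrite sumrB big_split /= -mulr_sumr.
  have -> : \sum_(b | H (pi a) b) m (pi a) b *
      ((clift a b == y)%:R * ((a == x)%:R * G u y)) = (a == x)%:R * (mu * G u y).
    have [->|ax] := eqVneq a x; first by rewrite sum_lift_single //= /mu; ring.
    by rewrite big1 => [|b _] /=; ring.
  have -> : \sum_(b | H (pi a) b) m (pi a) b *
      ((clift a b == x)%:R * ((a == y)%:R * G u x)) = (a == y)%:R * (mu * G u x).
    have [->|ay] := eqVneq a y.
      rewrite sum_lift_single 1?adj_sym // /mu (weightC hxy) /=; ring.
    by rewrite big1 => [|b _] /=; ring.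
  by rewrite /=; ring.
rewrite sumE op_apply_green; have [au|_] := eqVneq a u; last by rewrite /=; ring.
by rewrite au (negPf su) /=; ring.
Qed.

(** For [u = x] and [z = y] the cut identity reads $G(x,y)=m\,(G(x,y)^2-G(x,x)G(y,y))$ with $m\ne0$,
    so $G(x,y)=0$ would force a diagonal entry to vanish. *)
Lemma green_adj_neq0 x y : T x y -> G x y != 0.
Proof.
move=> xy; apply/negP => /eqP e.
have := green_cut y xy (side_tail treeT x y).
rewrite (_ : tside x y y); last exact: side_head.
rewrite e mul0r sub0r => /esym/eqP.
rewrite mulf_eq0 oppr_eq0 mulf_eq0 !(negPf (G_diag _)) orbF.
by rewrite (negPf (weight_neq0 (cover_hom Hcover xy))).
Qed.

(** The cut identity at [x] has left side 0, so [G u y * G x x = G u x * G y x], and the case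
    [u = x] gives [G x y = G y x]. Substituting these relates the identities at [z] for rows [u] and
    [x]. *)
Lemma green_factor u x y z : tside x y z -> ~~ tside x y u ->
  G u z * G x x = G u x * G x z.
Proof.
move=> sz su; have xy := side_adj sz.
have tx := side_tail treeT x y.
have mu0 := weight_neq0 (cover_hom Hcover xy).
have := green_cut z xy su; rewrite sz => e1.
have := green_cut z xy tx; rewrite sz => e2.
have := green_cut x xy su; rewrite (negPf tx) => /esym/eqP.
rewrite mulf_eq0 (negPf mu0) subr_eq0 /= => /eqP e.
have := green_cut x xy tx; rewrite (negPf tx) => /esym/eqP.
rewrite mulf_eq0 (negPf mu0) subr_eq0 /= mulrC => /eqP /(mulfI (G_diag x)) e'.
rewrite {}e1 [in RHS]e2.
have -> : m (pi x) (pi y) * (G u y * G x z - G u x * G y z) * G x x =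
   m (pi x) (pi y) * ((G u y * G x x) * G x z - G u x * G x x * G y z) by ring.
by rewrite e e'; ring.
Qed.

(** The pullback of row [x'] along a deck map lies in $\ell^2$ by injectivity and is sent to
    [delta x] by [M], so it is row [x]. *)
Lemma green_deck x x' y y' : pi x = pi x' -> pi y = pi y' -> T x y -> T x' y' ->
  G x y = G x' y' /\ G x x = G x' x'.
Proof.
move=> xx' yy' xy xy'.
have [phi [phi_inj phix piphi hom]] := deck_exists Hcover xx'.
have phi_lift a b : H (pi a) b -> clift (phi a) b = phi (clift a b).
  move=> ab; have [ac cb] := cliftP Hcover ab.
  by rewrite -{1}cb -(piphi (clift a b)) (clift_pi Hcover) // hom.
have compP : (fun z => G x' (phi z)) \in @l2_pred R VT.
  apply: l2_predP; apply: (@summableR_seq _ _ _ (l2norm (N (delta x')) ^+ 2) _ _).1.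
    by move=> z; rewrite sqr_ge0.
  move=> F uF; rewrite -(big_map phi predT (fun z => normc (G x' z) ^+ 2)).
  by apply: sum_normc_le; rewrite map_inj_uniq.
pose h : l2 := L2 compP.
have hG : h = N (delta x).
  rewrite -(MK h); congr (N _); apply: l2_ext => a; rewrite opE deltaE.
  rewrite -(inj_eq phi_inj) phix -(op_apply_green x' (phi a)) /op_apply piphi.
  by congr (_ + _); apply: eq_bigr => b ab; rewrite phi_lift.
have hE z : G x z = G x' (phi z) by rewrite /G -hG.
rewrite !hE phix; split=> //; congr (G x' _).
rewrite -[y in LHS](clift_pi Hcover xy) -phi_lift ?(cover_hom Hcover xy) //.
by rewrite phix yy' (clift_pi Hcover).
Qed.

Lemma ratio_of_green : exists2 r : dedge H -> R[i],
  ratio_system m r & decay_rate r < 1.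
Proof.
have [sec secP] : exists sec : VH -> VT, forall a, pi (sec a) = a.
  by have /choice[s hs] := cover_surj Hcover Hconn; exists s.
(* The section picks one lift of each vertex; [rhoE] shows that the ratio is the same over every
   lift. *)
pose rho a b := G (sec a) (clift (sec a) b) / G (sec a) (sec a).
have rhoE x y : T x y -> rho (pi x) (pi y) = G x y / G x x.
  move=> xy; have hxy := cover_hom Hcover xy; rewrite /rho.
  have [] := cliftP Hcover (x := sec (pi x)) (b := pi y); first by rewrite secP.
  by move=> h1 h2; have [-> ->] := green_deck (secP (pi x)) h2 h1 xy.
pose r (e : dedge H) := rho (tail e) (head e).
have step x y z : T x y -> T y z -> z != x -> G x z = G x y * rho (pi y) (pi z).
  move=> xy yz zx; rewrite (rhoE _ _ yz) mulrA.
  rewrite -(@green_factor x y z z) ?mulfK ?side_head //.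
  apply/negP => /(side_uniq (side_head treeT _)) e.
  by move: zx; rewrite -e ?eqxx // adj_sym.
have edgeP (e : dedge H) : exists x y, [/\ T x y, pi x = tail e & pi y = head e].
  elim/dedge_ind_pair: e => a b ab.
  exact: (cover_edge_surj Hcover Hconn ab).
have r_neq0 e : r e != 0.
  have [x [y [xy xe ye]]] := edgeP e.
  rewrite /r -xe -ye rhoE //; apply: mulf_neq0; first exact: green_adj_neq0.
  by rewrite invr_eq0.
exists r.
  split=> // e; rewrite /edge_value.
  have [x [y [xy xe ye]]] := edgeP e.
  rewrite (sum_follows (fun a b => m a b * rho a b)) /r -[head (dinv e)]/(tail e).
  rewrite -[tail (dinv e)]/(head e) -xe -ye rhoE //.
  have yx : T y x by rewrite adj_sym.
  (* [M] applied to row [x] of [G] vanishes at [y]; dividing by [G x y] turns this into the ratio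
     equation. *)
  have := op_apply_green x y; rewrite /op_apply.
  have -> : (y == x) = false by apply: contraTF xy => /eqP ->; rewrite adj_irr.
  rewrite (bigD1 (pi x)) /=; last exact: (cover_hom Hcover yx).
  rewrite (clift_pi Hcover yx) => /(congr1 (fun u => u / G x y)).
  rewrite mul0r => key; rewrite -[X in X = _]key !mulrDl mulfK ?green_adj_neq0 // addrA.
  rewrite invf_div mulrA; congr (_ + _).
  rewrite mulr_suml; apply: eq_bigr => b /andP[yb bx].
  have [yw pw] := cliftP Hcover yb.
  rewrite (step x y (clift y b)) // ?pw; first by field; exact: green_adj_neq0.
  by apply: contra bx => /eqP e'; rewrite -pw e'.
pose sq x y z := if tside x y z then normc (G x z) ^+ 2 else 0.
have sq0 x y z : 0 <= sq x y z by rewrite /sq; case: ifP => // _; rewrite sqr_ge0.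
have sq_sum x y : summableR (sq x y).
  apply: summableR_le (sqnorm_summable (N (delta x))) => z.
  by rewrite /sq; case: ifP => // _; rewrite normr0.
pose W x y := psum (sq x y) / normc (G x y) ^+ 2.
have W0 x y : 0 <= W x y by rewrite divr_ge0 ?sqr_ge0 // psum_ge0.
(* The side of [y] consists of [y] and the sides of its further neighbours, and [green_factor]
   rescales the mass of row [x] on these to that of row [y]. *)
have Wle x y : T x y -> 1 + \sum_(b | H (pi y) b && (b != pi x))
    normc (rho (pi y) b) ^+ 2 * W y (clift y b) <= W x y.
  move=> xy; have yx : T y x by rewrite adj_sym.
  set n2 := normc (G x y) ^+ 2.
  have n2_gt0 : 0 < n2.
    by rewrite exprn_gt0 // lt_neqAle eq_sym normc_eq0 green_adj_neq0 // normc_ge0.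
  rewrite /W -/n2 ler_pdivlMr // mulrDl mul1r mulr_suml.
  pose u0 z := if z == y then n2 else 0.
  pose v b z := if tside y (clift y b) z then normc (G x z) ^+ 2 else 0.
  have sG : summableR (fun z => normc (G x z) ^+ 2).
    exact: sqnorm_summable (N (delta x)).
  have v0 b z : 0 <= v b z by rewrite /v; case: ifP => // _; rewrite sqr_ge0.
  have sv b : summableR (v b).
    by apply: summableR_le sG => z; rewrite /v; case: ifP => // _; rewrite normr0.
  have u00 z : 0 <= u0 z by rewrite /u0; case: ifP => // _; exact: ltW.
  have su0 : summableR u0.
    apply: summableR_le sG => z; rewrite /u0; case: eqP => [->//|_].
    by rewrite normr0.
  have e0 : psum u0 = n2.
    rewrite (@psum_single _ _ _ y) //; first by rewrite /u0 eqxx.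
    by move=> z zy; rewrite /u0 (negPf zy).
  rewrite (eq_bigr (fun b => psum (v b))); last first.
    move=> b /andP[yb bx]; have [yw pw] := cliftP Hcover yb.
    set w := clift y b in yw pw *.
    have wx : w != x by apply: contra bx => /eqP e; rewrite -pw e.
    have sx : ~~ tside y w x.
      apply/negP => /(side_uniq (side_head treeT yx)) e.
      by rewrite -e eqxx in wx.
    have Gyy : normc (G y y) != 0 by rewrite normc_eq0.
    have Gyw : normc (G y w) != 0 by rewrite normc_eq0 green_adj_neq0.
    have -> : v b = (fun z => n2 / normc (G y y) ^+ 2 * sq y w z).
      apply/funext => z; rewrite /v /sq -/w; case: ifP => sz; last by rewrite mulr0.
      have /(congr1 (fun u => normc u ^+ 2)) := green_factor sz sx.
      rewrite !ComplexField.Normc.normcM !exprMn -/n2 => e.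
      apply: (mulIf (x := normc (G y y) ^+ 2)); first by rewrite expf_neq0.
      by rewrite e; field.
    rewrite psumZ ?divr_ge0 ?sqr_ge0 // -pw rhoE //.
    rewrite ComplexField.Normc.normcM ComplexField.Normc.normcV -/w.
    by field; rewrite Gyy Gyw.
  have [ssum <-] := psum_sum (index_enum VH)
    (fun b => H (pi y) b && (b != pi x)) v0 sv.
  rewrite -{1}e0 -psumD //; last by move=> z; apply: sumr_ge0.
  apply: psum_le => // [z|z]; first by rewrite addr_ge0 // sumr_ge0.
  rewrite /u0; have [->|zy] := eqVneq z y.
    rewrite big1 ?addr0; first by rewrite /sq side_head.
    by move=> b _; rewrite /v (negPf (side_tail _ _ _)).
  rewrite add0r.
  have [[b [yb bx sb]]|nb] := pselect (exists b, [/\ H (pi y) b, b != pi x &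
      tside y (clift y b) z]); last first.
    rewrite big1 // => b /andP[yb bx]; rewrite /v; case: ifP => // sb.
    by case: nb; exists b.
  have [yw pw] := cliftP Hcover yb.
  rewrite (bigD1 b) /= ?yb // big1 ?addr0.
    rewrite /v sb /sq (@side_sub _ _ treeT x y (clift y b)) //.
    by apply: contra bx => /eqP e; rewrite -pw e.
  move=> c /andP[/andP[yc _] cb]; rewrite /v; case: ifP => // sc.
  have [_ pc] := cliftP Hcover yc.
  by rewrite -pc (side_uniq sc sb) pw eqxx in cb.
(* [W] lives on edges of [T]. Its infimum over the lifts of an edge lives on edges of [H], and the
   inequality survives because its left side is monotone in the weights. *)
pose S (e : dedge H) := [set W p.1 p.2 | p in
  [set p | [/\ T p.1 p.2, pi p.1 = tail e & pi p.2 = head e]]]%classic.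
have S_lb e : has_lbound (S e) by exists 0 => _ [p _ <-].
have S_ne e : (S e !=set0)%classic.
  by have [x [y h]] := edgeP e; exists (W x y), (x, y).
pose w e := inf (S e).
have w0 e : 0 <= w e by apply: lb_le_inf => // _ [p _ <-].
apply: (@decay_rate_lt1 _ _ _ _ w) => // e.
apply: lb_le_inf => // _ [[x y] /= [xy xe ye] <-].
apply: le_trans (Wle _ _ xy); rewrite lerD2l.
pose wp := pairfun 0 w.
rewrite (eq_bigr (fun f => normc (rho (tail f) (head f)) ^+ 2 *
    wp (tail f) (head f))); last first.
  by elim/dedge_ind_pair => a b ab _; rewrite /wp (pairfunE _ _ ab).
rewrite (sum_follows (fun a b => normc (rho a b) ^+ 2 * wp a b)) xe -ye.
apply: ler_sum => b /andP[yb bx]; rewrite ler_wpM2l ?sqr_ge0 //.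
rewrite /wp (pairfunE _ _ yb); apply: inf_lbound => //.
by have [? ?] := cliftP Hcover yb; exists (y, clift y b).
Qed.

End Inverse.

End Operator.

(** * Sums over the tree *)

Section TreeSums.
Variables (R : realType) (VH : finType) (VT : choiceType).
Variables (H : sgraph VH) (T : sgraph VT) (pi : VT -> VH).
Hypothesis Hcover : universal_cover T H pi.
Local Notation clift := (clift T pi).
Local Notation treeT := (cover_tree Hcover).
Local Notation tside := (side treeT).

(** The tree is the disjoint union of [x] and the branches at [x]; [Q] lists the branches that [P]
    may meet. *)
Lemma star_sum_le (f : VT -> R) x (F : seq VT) (P : pred VT) (Q : pred VH) :
  (forall z, 0 <= f z) -> uniq F -> (forall b, Q b -> H (pi x) b) ->
  (forall z, P z -> z != x -> exists2 b, Q b & tside x (clift x b) z) ->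
  \sum_(z <- F | P z) f z <=
    f x + \sum_(b | Q b) \sum_(z <- F | tside x (clift x b) z) f z.
Proof.
move=> f0 uF QH PQ; rewrite (bigID (pred1 x)) /=; apply: lerD.
  apply: (@le_trans _ _ (\sum_(z <- F | z == x) f z)).
    rewrite big_mkcondl /=; apply: ler_sum => z _; case: ifP => //.
  rewrite -big_filter; have : uniq (seq.filter (pred1 x) F) by rewrite filter_uniq.
  have : all (pred1 x) (seq.filter (pred1 x) F) by exact: filter_all.
  case: (seq.filter _ F) => [|a [|b s]] /=; first by rewrite big_nil f0.
    by rewrite andbT big_seq1 => /eqP ->.
  by move=> /and3P[/eqP -> /eqP -> _]; rewrite inE eqxx.
pose br z := pi (seq.head x (tpath treeT x z)).
have brE z b : Q b -> tside x (clift x b) z -> br z = b.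
  move=> /QH xb /eqP e; rewrite /br e /=; exact: (pi_clift Hcover xb).
rewrite (partition_big br Q) /=; last first.
  by move=> z /andP[/PQ h /h[b Qb sb]]; rewrite (brE _ _ Qb sb).
apply: ler_sum => b Qb; rewrite [leLHS]big_mkcond [leRHS]big_mkcond /=.
apply: ler_sum => z _; case: ifP => [/andP[/andP[Pz zx] /eqP bz]|_].
  have [b' Qb' sb'] := PQ _ Pz zx.
  by rewrite -bz (brE _ _ Qb' sb') sb'.
by case: ifP.
Qed.

Section Dominated.
Variables (q Phi : VT -> VT -> R) (h : VT -> R).
Hypotheses (q0 : forall x y, 0 <= q x y) (Phi0 : forall x y, 0 <= Phi x y).
Hypothesis h0 : forall x, 0 <= h x.
Hypothesis Phi_super : forall x y, T x y ->
  q x y * (h y + \sum_(b | H (pi y) b && (b != pi x)) Phi y (clift y b)) <= Phi x y.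

Lemma gprod_ge0 x z : 0 <= gprod treeT q x z.
Proof.
rewrite /gprod; move: (tpath _ x z) => p; elim: p x => [|y p IH] x //=.
by rewrite mulr_ge0.
Qed.

(** [Phi_super] says that [Phi] dominates one step of the recursion for side sums. As [F] is finite,
    induction on a bound for the distance from [y] to its points applies. *)
Lemma side_sum_le (F : seq VT) x y : uniq F -> T x y ->
  \sum_(z <- F | tside x y z) gprod treeT q x z * h z <= Phi x y.
Proof.
move=> uF; have [n nP] : exists n, forall x z, z \in F -> tside x y z ->
    (size (tpath treeT y z) < n)%N.
  exists (\max_(z <- F) size (tpath treeT y z)).+1 => _ z zF _.
  by rewrite ltnS (big_rem z) //= leq_maxl.
move: {nP}(nP x); elim: n x y => [|n IH] x y nP xy.
  by rewrite big1_seq // => z /andP[s /nP/(_ s)].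
apply: le_trans (Phi_super xy).
rewrite (eq_bigr (fun z => q x y * (gprod treeT q y z * h z))); last first.
  by move=> z s; rewrite (gprod_first _ s) mulrA.
rewrite -mulr_sumr ler_wpM2l //.
apply: le_trans
  (star_sum_le (x := y) (Q := fun b => H (pi y) b && (b != pi x)) _ uF _ _) _.
- by move=> z; rewrite mulr_ge0 ?gprod_ge0.
- by move=> b /andP[].
- move=> z s zy; have [w [yw wx sw]] := side_step s zy.
  exists (pi w); last by rewrite (clift_pi Hcover yw).
  rewrite (cover_hom Hcover yw); apply: contra wx => /eqP e.
  have yx : T y x by rewrite adj_sym.
  by rewrite -(clift_pi Hcover yw) e (clift_pi Hcover yx).
rewrite gprod_id mul1r lerD2l; apply: ler_sum => b /andP[yb bx].
have [yw pw] := cliftP Hcover yb.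
apply: IH => // z zF s; rewrite -ltnS.
have sxy : tside x y z.
  by apply: side_sub s => //; apply: contra bx => /eqP e; rewrite -pw e.
by have := nP z zF sxy; move/eqP: s => ->.
Qed.

Lemma tree_sum_le (F : seq VT) x : uniq F ->
  \sum_(z <- F) gprod treeT q x z * h z <=
    h x + \sum_(b | H (pi x) b) Phi x (clift x b).
Proof.
move=> uF.
apply: le_trans (star_sum_le (x := x) (Q := fun b => H (pi x) b) _ uF _ _) _ => //.
- by move=> z; rewrite mulr_ge0 ?gprod_ge0.
- move=> z _ zx; have [y s] := side_ex treeT zx; have xy := side_adj s.
  by exists (pi y); [exact: (cover_hom Hcover xy)|rewrite (clift_pi Hcover xy)].
rewrite gprod_id mul1r lerD2l; apply: ler_sum => b xb.
by apply: side_sum_le => //; apply: clift_adj Hcover _ _ xb.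
Qed.

End Dominated.

Lemma normc_gprod (q : VT -> VT -> R[i]) x z :
  normc (gprod treeT q x z) = gprod treeT (fun x y => normc (q x y)) x z.
Proof.
rewrite /gprod; move: (tpath _ x z) => p; elim: p x => [|y p IH] x /=.
  exact: ComplexField.Normc.normc1.
by rewrite ComplexField.Normc.normcM IH.
Qed.

Lemma gprod_sqr (q : VT -> VT -> R) x z :
  gprod treeT q x z ^+ 2 = gprod treeT (fun x y => q x y ^+ 2) x z.
Proof.
rewrite /gprod; move: (tpath _ x z) => p; elim: p x => [|y p IH] x /=.
  by rewrite expr1n.
by rewrite exprMn IH.
Qed.

Lemma gprod_gt0 (q : VT -> VT -> R) x z : (forall a b, T a b -> 0 < q a b) ->
  0 < gprod treeT q x z.
Proof.
move=> q0; rewrite /gprod; have /and3P[+ _ _] := simple_tpath treeT x z.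
move: (tpath _ x z) => p; elim: p x => [|y p IH] x //= /andP[xy py].
by rewrite mulr_gt0 ?q0 ?IH.
Qed.

End TreeSums.

(** Cauchy-Schwarz for $\sqrt{kh}$ and $\sqrt{k/h}\,f$; induction on the list avoids the square
    roots. *)
Lemma schur_cauchy_schwarz (R : realType) (I : Type) (s : seq I) (k h f : I -> R) :
  (forall i, 0 <= k i) -> (forall i, 0 < h i) -> (forall i, 0 <= f i) ->
  (\sum_(i <- s) k i * f i) ^+ 2 <=
  (\sum_(i <- s) k i * h i) * (\sum_(i <- s) k i * (f i ^+ 2 / h i)).
Proof.
move=> k0 h0 f0; elim: s => [|i s IH]; first by rewrite !big_nil expr0n mul0r.
rewrite !big_cons.
have : 0 <= \sum_(j <- s) k j * f j by apply: sumr_ge0 => j _; rewrite mulr_ge0.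
have : 0 <= \sum_(j <- s) k j * h j.
  by apply: sumr_ge0 => j _; rewrite mulr_ge0 // ltW.
have : 0 <= \sum_(j <- s) k j * (f j ^+ 2 / h j).
  by apply: sumr_ge0 => j _; rewrite mulr_ge0 // divr_ge0 ?sqr_ge0 // ltW.
move: IH; move: (\sum_(j <- s) _ * f _) => a; move: (\sum_(j <- s) _ * h _) => b.
move: (\sum_(j <- s) _) => c ab c0 b0 a0.
have hi := h0 i; have ki := k0 i; have fi := f0 i.
move: (h i) (k i) (f i) hi ki fi => H K F H0 K0 F0.
(* The cross term of the induction step, from [a ^ 2 <= b * c] and the inequality of arithmetic and
   geometric means. *)
have amgm : 2 * a * F <= b * (F ^+ 2 / H) + c * H.
  rewrite -(ler_pXn2r (n := 2)) ?nnegrE; first last.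
  - have H1 := ltW H0; apply: addr_ge0; apply: mulr_ge0 => //.
    by rewrite divr_ge0 ?sqr_ge0.
  - by rewrite !mulr_ge0.
  - by [].
  have -> : (b * (F ^+ 2 / H) + c * H) ^+ 2 =
      (b * (F ^+ 2 / H) - c * H) ^+ 2 + 4 * (b * c) * F ^+ 2.
    by field; rewrite gt_eqF.
  have := sqr_ge0 (b * (F ^+ 2 / H) - c * H).
  have : a ^+ 2 * F ^+ 2 <= b * c * F ^+ 2 by rewrite ler_wpM2r ?sqr_ge0.
  have -> : (2 * a * F) ^+ 2 = 4 * (a ^+ 2 * F ^+ 2) by ring.
  by lra.
have -> : (K * H + b) * (K * (F ^+ 2 / H) + c) =
    b * c + K * (b * (F ^+ 2 / H) + c * H) + K ^+ 2 * F ^+ 2.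
  by field; rewrite gt_eqF.
have -> : (K * F + a) ^+ 2 = a ^+ 2 + K * (2 * a * F) + K ^+ 2 * F ^+ 2 by ring.
by rewrite lerD2r lerD // ler_wpM2l.
Qed.

(** * Ratio equations and poles *)

Section RatioSystem.
Variables (R : realType) (VH : finType) (H : sgraph VH) (m : VH -> VH -> R[i]).
Hypothesis Hconn : graph_connected H.
Hypothesis m_sym : forall a b, H a b -> m a b = m b a.
Hypothesis m_neq0 : forall a b, H a b -> m a b != 0.
Variables (r : dedge H -> R[i]) (w : dedge H -> R).
Hypothesis r_ratio : ratio_system m r.
Hypothesis w_eq : forall e, 1 <= w e /\
  w e = 1 + \sum_(f : dedge H | follows e f) normc (r f) ^+ 2 * w f.

(** The default 1 keeps the ratios nonzero and, in [weight_fun], the weights at least 1 on all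
    pairs. *)
Definition ratio_fun := pairfun 1 r.
Definition weight_fun := pairfun 1 w.
Local Notation rho := ratio_fun.
Local Notation om := weight_fun.

Lemma ratio_fun_neq0 a b : rho a b != 0.
Proof.
rewrite /rho /pairfun; case: (insub _) => [e|]; last exact: oner_neq0.
by case: r_ratio => ->.
Qed.

Lemma weight_fun_ge1 a b : 1 <= om a b.
Proof. by rewrite /om /pairfun; case: (insub _) => // e; case: (w_eq e). Qed.

Lemma ratio_fun_eq a b : H a b -> 0 = m b b + m b a / rho a b +
  \sum_(c | H b c && (c != a)) m b c * rho b c.
Proof.
move=> ab; have [_ /(_ (mkdedge ab))] := r_ratio.
rewrite /edge_value /rho (pairfunE _ _ ab) => {1}->; congr (_ + _).
rewrite -(sum_follows (fun a b => m a b * pairfun 1 r a b) (mkdedge ab)).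
by apply: eq_bigr; elim/dedge_ind_pair => a' b' ab' _; rewrite (pairfunE _ _ ab').
Qed.

Lemma weight_fun_eq a b : H a b ->
  om a b = 1 + \sum_(c | H b c && (c != a)) normc (rho b c) ^+ 2 * om b c.
Proof.
move=> ab; have [_] := w_eq (mkdedge ab).
rewrite {1}/om (pairfunE _ _ ab) => {1}->; congr (_ + _).
rewrite -(sum_follows (fun a b => normc (rho a b) ^+ 2 * om a b) (mkdedge ab)).
apply: eq_bigr; elim/dedge_ind_pair => a' b' ab' _.
by rewrite /rho /om !(pairfunE _ _ ab').
Qed.

(* The value at [a] of [M g], where [g] is the product of the ratios along the
   path from [a]. *)
Definition pole a : R[i] := m a a + \sum_(b | H a b) m a b * rho a b.

(** Subtracting the ratio equation of [(a, b)] leaves only the terms of the neighbour [a]. *)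
Lemma pole_edge a b : H a b -> pole b = m b a * (rho b a - (rho a b)^-1).
Proof.
move=> ab; have ba : H b a by rewrite adj_sym.
rewrite /pole (bigD1 a) //=.
transitivity ((m b b + m b a / rho a b + \sum_(c | H b c && (c != a)) m b c * rho b c)
  + m b a * (rho b a - (rho a b)^-1)); first by ring.
by rewrite -ratio_fun_eq // add0r.
Qed.

(** By [pole_edge] both sides equal [m a b * (rho a b * rho b a - 1)]. *)
Lemma pole_sym a b : H a b -> rho a b * pole b = rho b a * pole a.
Proof.
move=> ab; have ba : H b a by rewrite adj_sym.
rewrite (pole_edge ab) (pole_edge ba) (m_sym ab).
have := ratio_fun_neq0 a b; have := ratio_fun_neq0 b a.
by move: (rho a b) (rho b a) => x y x0 y0; field; rewrite x0 y0.
Qed.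

Lemma pole_neq0 : ~ graph_acyclic H -> forall a, pole a != 0.
Proof.
move=> cyc a0; apply/negP => /eqP p0; apply: cyc.
have pole_prop a b : H a b -> pole a = 0 -> pole b = 0.
  move=> ab pa; have := pole_sym ab; rewrite pa mulr0 => /eqP.
  by rewrite mulf_eq0 (negPf (ratio_fun_neq0 a b)) /= => /eqP.
have pole0 a : pole a = 0.
  have [_ /(_ a0 a)[p pp ->]] := Hconn.
  elim: p a0 p0 pp => [//|b p IH] c pc /= /andP[cb].
  by apply: IH; apply: pole_prop cb pc.
have inv a b : H a b -> rho b a = (rho a b)^-1.
  move=> ab; have ba : H b a by rewrite adj_sym.
  have := pole_edge ab; rewrite pole0 => /esym/eqP.
  by rewrite mulf_eq0 (negPf (m_neq0 ba)) subr_eq0 /= => /eqP.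
have om_gt a b c : H a b -> H b c -> c != a -> normc (rho b c) ^+ 2 * om b c < om a b.
  move=> ab bc ca; rewrite (weight_fun_eq ab) (bigD1 c) ?bc //=.
  have : 0 <= \sum_(d | (H b d && (d != a)) && (d != c)) normc (rho b d) ^+ 2 * om b d.
    apply: sumr_ge0 => d /andP[/andP[bd _] _]; apply: mulr_ge0; first exact: sqr_ge0.
    exact: le_trans ler01 (weight_fun_ge1 b d).
  by lra.
apply: (@acyclic_decreasing _ H _ R
  (fun a b => normc (rho a b) ^+ 2 * om a b / om b a)) => a b c ab bc ca.
have ba : H b a by rewrite adj_sym.
have cb : H c b by rewrite adj_sym.
have om0 x y : 0 < om x y by apply: lt_le_trans (weight_fun_ge1 x y).
have n0 : 0 < normc (rho a b) ^+ 2.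
  by rewrite exprn_gt0 // lt_neqAle eq_sym normc_eq0 ratio_fun_neq0 // normc_ge0.
have h1 := om_gt _ _ _ ab bc ca.
(* This is [om_gt] for the reversed walk [c], [b], [a], whose ratio is the inverse of [rho a b];
   with [h1] it gives the decrease along [a], [b], [c]. *)
have h2 : om b a < om c b * normc (rho a b) ^+ 2.
  have := om_gt _ _ _ cb ba; rewrite eq_sym ca => /(_ isT).
  rewrite (inv _ _ ab) ComplexField.Normc.normcV exprVn => h.
  by rewrite -ltr_pdivrMr // mulrC.
rewrite ltr_pdivrMr ?om0 // [ltRHS]mulrAC ltr_pdivlMr ?om0 //.
apply: (@lt_trans _ _ (om a b * om b a)); first by rewrite ltr_pM2r ?om0.
have -> : normc (rho a b) ^+ 2 * om a b * om c b =
    om a b * (om c b * normc (rho a b) ^+ 2) by ring.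
by rewrite ltr_pM2l ?om0.
Qed.

End RatioSystem.

(** * From a ratio system to the inverse *)

Lemma linear_fun_exists (K : pzRingType) (U V : lmodType K) (f : U -> V) :
  linear f -> exists g : {linear U -> V}, forall x, g x = f x.
Proof.
move=> lf; pose L := GRing.isLinear.Build _ _ _ _ f lf.
pose g : {linear U -> V} := HB.pack f L.
by exists g.
Qed.

Section Backward.
Variables (R : realType) (VH : finType) (VT : choiceType).
Variables (H : sgraph VH) (T : sgraph VT) (pi : VT -> VH).
Variables (M : {linear l2 R VT -> l2 R VT}) (m : VH -> VH -> R[i]).
Hypotheses (Hconn : graph_connected H) (Hcover : universal_cover T H pi).
Hypotheses (Msym : op_symmetric M) (Mlocal : op_local T M).
Hypotheses (Mconn : op_connected T M) (Mpull : pulled_back T pi M m).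
Hypothesis Hcyc : ~ graph_acyclic H.
Variables (r : dedge H -> R[i]) (w : dedge H -> R).
Hypothesis r_ratio : ratio_system m r.
Hypothesis w_eq : forall e, 1 <= w e /\
  w e = 1 + \sum_(f : dedge H | follows e f) normc (r f) ^+ 2 * w f.
Local Notation l2 := (l2 R VT).
Local Notation delta := (@delta R VT).
Local Notation clift := (clift T pi).
Local Notation treeT := (cover_tree Hcover).
Local Notation tside := (side treeT).
Local Notation rho := (ratio_fun r).
Local Notation om := (weight_fun w).
Local Notation p := (pole m r).

Let Mop f x : M f x = op_apply H T pi m f x.
Proof. exact: opE. Qed.
Let m_sym a b : H a b -> m a b = m b a.
Proof. exact: (weightC Hconn Hcover Msym Mpull). Qed.
Let m_neq0 a b : H a b -> m a b != 0.
Proof. exact: (weight_neq0 Hconn Hcover Mconn Mpull). Qed.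
Let rho_neq0 a b : rho a b != 0.
Proof. exact: (ratio_fun_neq0 r_ratio). Qed.
Let om_ge1 a b : 1 <= om a b.
Proof. exact: (weight_fun_ge1 w_eq). Qed.
Let p_neq0 a : p a != 0.
Proof. exact: (pole_neq0 Hconn m_sym m_neq0 r_ratio w_eq Hcyc). Qed.

Let qT x y := rho (pi x) (pi y).
Let G u z := gprod treeT qT u z / p (pi u).

(** Induction along the path: [pole_sym] reverses its last edge at the price of moving the pole from
    [z] to [y]. *)
Let G_sym u z : G u z = G z u.
Proof.
suff e : gprod treeT qT u z * p (pi z) = gprod treeT qT z u * p (pi u).
  rewrite /G; apply: (mulIf (p_neq0 (pi z))); rewrite mulrAC e mulfVK //.
  by rewrite mulfK.
have [n] := ubnP (size (tpath treeT z u)); elim: n z => // n IH z.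
have [->//|uz] := eqVneq u z.
have [y s] := side_ex treeT uz; have /eqP zu := s.
have hyz : H (pi y) (pi z) by rewrite adj_sym (cover_hom Hcover) // (side_adj s).
rewrite zu ltnS /= => /IH e; rewrite (gprod_last _ s) (gprod_first _ s).
transitivity (gprod treeT qT u y * (qT y z * p (pi z))); first by ring.
rewrite /qT (pole_sym m_sym r_ratio hyz) -/(qT z y) mulrCA e; ring.
Qed.

(** At [u] this is the definition of the pole. Elsewhere, with [y] the neighbour of [z] towards [u],
    it is a multiple of the ratio equation of [(pi y, pi z)]. *)
Let G_apply u z : op_apply H T pi m (G u) z = (z == u)%:R.
Proof.
pose g := gprod treeT qT u.
have -> : op_apply H T pi m (G u) z = op_apply H T pi m g z / p (pi u).
  rewrite /op_apply mulrDl mulr_suml mulrA; congr (_ + _).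
  by apply: eq_bigr => b _; rewrite mulrA.
have [->|zu] := eqVneq z u.
  suff -> : op_apply H T pi m g u = p (pi u) by rewrite divff.
  rewrite /op_apply /g gprod_id mulr1; congr (_ + _); apply: eq_bigr => b ub.
  have [uy py] := cliftP Hcover ub.
  by rewrite (gprod_first _ (side_head treeT uy)) gprod_id mulr1 /qT py.
rewrite (_ : op_apply H T pi m g z = 0) ?mul0r //.
have uz : u != z by rewrite eq_sym.
have [y s] := side_ex treeT uz; have zy := side_adj s.
have yz : T y z by rewrite adj_sym.
have hzy := cover_hom Hcover zy; have hyz := cover_hom Hcover yz.
have gz : g z = g y * rho (pi y) (pi z) by exact: gprod_last.
rewrite /op_apply (bigD1 (pi y)) //= (clift_pi Hcover zy).
have -> : g y = g z / rho (pi y) (pi z) by rewrite gz mulfK.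
rewrite (eq_bigr (fun b => g z * (m (pi z) b * rho (pi z) b))); last first.
  move=> b /andP[zb by_]; have [zc pc] := cliftP Hcover zb.
  have cz : T (clift z b) z by rewrite adj_sym.
  have s' : tside (clift z b) z u.
    rewrite (sideC treeT u zc); apply: contra by_ => /(side_uniq s) e.
    by rewrite -pc -e.
  by rewrite /g (gprod_last _ s') /qT pc; ring.
rewrite -mulr_sumr.
transitivity (g z * (m (pi z) (pi z) + m (pi z) (pi y) / rho (pi y) (pi z) +
  \sum_(b | H (pi z) b && (b != pi y)) m (pi z) b * rho (pi z) b)); first by ring.
by rewrite -(ratio_fun_eq r_ratio hyz) mulr0.
Qed.

Let absq x y : R := normc (qT x y).
Let absq_gt0 x y : 0 < absq x y.
Proof. by rewrite lt_neqAle eq_sym normc_eq0 rho_neq0 normc_ge0. Qed.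

Let gam a : R := normc (p a).
Let gam_gt0 a : 0 < gam a.
Proof. by rewrite lt_neqAle eq_sym normc_eq0 p_neq0 normc_ge0. Qed.

Let normG u z : normc (G u z) = gprod treeT absq u z / gam (pi u).
Proof.
by rewrite /G ComplexField.Normc.normcM ComplexField.Normc.normcV normc_gprod.
Qed.

(** The equation for [w] makes [Phi] solve the recursion for side sums of the squared ratios with
    weight 1. *)
Let G_l2 u : (fun z => G u z) \in @l2_pred R VT.
Proof.
apply: l2_predP.
pose Phi x y := absq x y ^+ 2 * om (pi x) (pi y).
have om0 a b : 0 <= om a b by apply: le_trans (om_ge1 a b).
have h (F : seq VT) : uniq F ->
    \sum_(z <- F) gprod treeT (fun x y => absq x y ^+ 2) u z * 1 <=
    1 + \sum_(b | H (pi u) b) Phi u (clift u b).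
  apply: (tree_sum_le Hcover (h := fun=> 1)) => [x y|x y|_|x y xy].
  - exact: sqr_ge0.
  - by rewrite mulr_ge0 ?sqr_ge0.
  - exact: ler01.
  - rewrite /Phi (weight_fun_eq w_eq (cover_hom Hcover xy)) ler_wpM2l ?sqr_ge0 //.
    rewrite lerD2l; apply: ler_sum => b /andP[yb _].
    by rewrite /absq /qT (pi_clift Hcover yb).
apply: (@summableR_seq _ _ _
  ((1 + \sum_(b | H (pi u) b) Phi u (clift u b)) / gam (pi u) ^+ 2) _ _).1.
  by move=> z; rewrite sqr_ge0.
move=> F /h; under eq_bigr do rewrite mulr1.
rewrite ler_pdivlMr ?exprn_gt0 // mulr_suml; apply: le_trans.
apply: ler_sum => z _; rewrite normG expr_div_n gprod_sqr mulfVK //.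
by rewrite expf_neq0 // gt_eqF.
Qed.

Let Gl u : l2 := L2 (G_l2 u).

(** * The Schur test *)

Section Schur.
Variables (o : VT) (K Gam beta C : R).
Hypothesis K_ge1 : 1 <= K.
Hypothesis K_om : forall a b, om a b <= K.
Hypothesis K_sum : forall a (Q : pred VH),
  \sum_(b | Q b) normc (rho a b) ^+ 2 * om a b <= K.
Hypothesis Gam_ge0 : 0 <= Gam.
Hypothesis Gam_inv : forall a, (gam a)^-1 <= Gam.
Hypothesis beta_ge0 : 0 <= beta.
Hypothesis beta_gam : forall a, 1 + (K ^+ 3 + K ^+ 2) <= beta * gam a / (K + 1).
Hypothesis C_ge0 : 0 <= C.
Hypothesis C_gam : forall a,
  Gam * (1 + (K ^+ 3 + K ^+ 2 + beta * gam a)) <= C.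

Let s : R := 1 + K^-1.
Let K_gt0 : 0 < K. Proof. exact: lt_le_trans K_ge1. Qed.
Let K1_gt0 : 0 < K + 1. Proof. exact: addr_gt0. Qed.
Let s_gt0 : 0 < s. Proof. by rewrite addr_gt0 // invr_gt0. Qed.

(* Weights for the Schur test, rooted at [o]: the factor [s > 1] makes the sums
   towards the root converge, and is small enough to keep those away from it. *)
Let h z : R := gprod treeT (fun x y => s * absq x y) o z.
Let h_gt0 z : 0 < h z.
Proof. by apply: gprod_gt0 => x y _; rewrite mulr_gt0. Qed.

(** Bounds for the weighted sums over sides: [om] controls a side without the root [o], and the
    poles control the side containing it. *)
Let Phi x y := if tside x y o then beta * gam (pi y) * (absq x y * h y)
  else K ^+ 2 * om (pi x) (pi y) * (absq x y * h y).

Let om_ge0 a b : 0 <= om a b. Proof. exact: le_trans (om_ge1 a b). Qed.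
Let gam_ge0 a : 0 <= gam a. Proof. exact: ltW. Qed.

Let Phi_ge0 x y : 0 <= Phi x y.
Proof.
have qh : 0 <= absq x y * h y by rewrite mulr_ge0 // ltW.
by rewrite /Phi; case: ifP => _; apply: mulr_ge0 => //; apply: mulr_ge0 => //;
  apply: sqr_ge0.
Qed.

(** Away from the root, [h z = h y * (s * absq y z)] squares the ratio, and
    [K ^ 2 * s = K ^ 2 + K]. *)
Let Phi_down y z : T y z -> ~~ tside y z o ->
  Phi y z = (K ^+ 2 + K) * h y * (absq y z ^+ 2 * om (pi y) (pi z)).
Proof.
move=> yz sn; rewrite /Phi (negPf sn).
have s' : tside z y o by rewrite (sideC treeT).
have -> : h z = h y * (s * absq y z) by exact: gprod_last.
by rewrite /s; field; rewrite gt_eqF.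
Qed.

(** Towards the root, [pole_sym] replaces the ratio by that of the inverse edge, which [h] absorbs;
    the gain is [1 / s = K / (K + 1)]. *)
Let Phi_up y z : tside y z o ->
  Phi y z = beta * gam (pi y) * (K / (K + 1)) * h y.
Proof.
move=> su; rewrite /Phi su; have yz := side_adj su.
have -> : h y = h z * (s * absq z y) by exact: gprod_last.
have e : absq y z * gam (pi z) = absq z y * gam (pi y).
  rewrite /absq /gam /qT -!ComplexField.Normc.normcM.
  by rewrite (pole_sym m_sym r_ratio (cover_hom Hcover yz)).
transitivity (beta * h z * (absq y z * gam (pi z))); first by ring.
by rewrite e /s; field; rewrite !gt_eqF.
Qed.

(** Branches away from the root contribute at most [(K ^ 2 + K) * K] by [K_sum], and at most one
    branch contains the root. *)
Let Phi_sum y (Q : pred VH) : (forall b, Q b -> H (pi y) b) ->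
  \sum_(b | Q b) Phi y (clift y b) <=
  (K ^+ 3 + K ^+ 2 + beta * gam (pi y) * (K / (K + 1))) * h y.
Proof.
move=> QH; have hy := ltW (h_gt0 y).
have KK : 0 <= (K ^+ 2 + K) * h y.
  by apply: mulr_ge0 => //; apply: addr_ge0; [exact: sqr_ge0|exact: ltW].
set X := beta * gam (pi y) * (K / (K + 1)) * h y.
have X0 : 0 <= X.
  apply: mulr_ge0 => //; apply: mulr_ge0; first exact: mulr_ge0.
  by rewrite divr_ge0 // ltW.
apply: (@le_trans _ _ (\sum_(b | Q b)
   ((K ^+ 2 + K) * h y * (normc (rho (pi y) b) ^+ 2 * om (pi y) b)
    + (if tside y (clift y b) o then X else 0)))).
  apply: ler_sum => b /QH yb; have [yc pc] := cliftP Hcover yb.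
  have t0 : 0 <= (K ^+ 2 + K) * h y * (normc (rho (pi y) b) ^+ 2 * om (pi y) b).
    by apply: mulr_ge0 => //; apply: mulr_ge0 => //; exact: sqr_ge0.
  case: ifPn => [su|sn]; first by rewrite (Phi_up su) -/X lerDr.
  by rewrite (Phi_down yc sn) /absq /qT pc addr0.
rewrite big_split /= [leRHS]mulrDl -/X; apply: lerD.
  rewrite -mulr_sumr.
  have -> : (K ^+ 3 + K ^+ 2) * h y = (K ^+ 2 + K) * h y * K by ring.
  exact: ler_wpM2l.
have [[b Qb sb]|nb] := pselect (exists2 b, Q b & tside y (clift y b) o); last first.
  by rewrite big1 // => b Qb; case: ifP => // sb; case: nb; exists b.
rewrite (bigD1 b) //= sb big1 ?addr0 // => c /andP[Qc cb]; case: ifP => // sc.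
have cE := pi_clift Hcover (QH _ Qc).
by rewrite -cE (side_uniq sc sb) (pi_clift Hcover (QH _ Qb)) eqxx in cb.
Qed.

Let Phi_super x y : T x y ->
  absq x y * (h y + \sum_(b | H (pi y) b && (b != pi x)) Phi y (clift y b)) <= Phi x y.
Proof.
move=> xy; have yx : T y x by rewrite adj_sym.
have hy := h_gt0 y; have qxy := absq_gt0 x y.
rewrite {2}/Phi; case: ifPn => su.
  rewrite mulrCA ler_pM2l //.
  apply: (le_trans (lerD (lexx _) (Phi_sum _))); first by move=> b /andP[].
  rewrite -[X in X + _]mul1r -mulrDl ler_pM2r // addrA.
  (* By [beta_gam], the share [1 / (K + 1)] pays for [y] itself and for the branches away from the
     root. *)
  have e : beta * gam (pi y) = beta * gam (pi y) / (K + 1) +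
      beta * gam (pi y) * (K / (K + 1)).
    by field; rewrite gt_eqF.
  by rewrite [leRHS]e lerD2r.
have su' : tside y x o by rewrite (sideC treeT).
rewrite mulrCA ler_pM2l //.
rewrite (eq_bigr (fun b => (K ^+ 2 + K) * h y *
    (normc (rho (pi y) b) ^+ 2 * om (pi y) b))); last first.
  move=> b /andP[yb bx]; have [yc pc] := cliftP Hcover yb.
  rewrite Phi_down // /absq /qT ?pc //.
  by apply: contra bx => /(side_uniq su') ->; rewrite pc.
rewrite -mulr_sumr.
have := weight_fun_eq w_eq (cover_hom Hcover xy).
move: (\sum_(b | _) _) => S e; have oK := K_om (pi x) (pi y).
have {e}-> : S = om (pi x) (pi y) - 1 by rewrite e; ring.
move: (om _ _) oK => W WK.
have -> : h y + (K ^+ 2 + K) * h y * (W - 1) = (1 + (K ^+ 2 + K) * (W - 1)) * h y by ring.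
rewrite ler_pM2r //.
(* What remains is [1 + K * W <= K ^ 2 + K]. *)
have : K * W <= K * K by rewrite ler_pM2l.
by have := K_ge1; rewrite expr2; lra.
Qed.

Let schur_row x (F : seq VT) : uniq F ->
  \sum_(z <- F) normc (G x z) * h z <= C * h x.
Proof.
move=> uF; have hx := h_gt0 x.
have := @tree_sum_le _ _ _ _ _ _ Hcover _ _ h (fun x y => ltW (absq_gt0 x y)) Phi_ge0
  (fun x => ltW (h_gt0 x)) Phi_super F x uF.
move=> /le_trans/(_ (lerD (lexx _) (Phi_sum (fun b xb => xb)))) le1.
apply: (@le_trans _ _ (Gam * \sum_(z <- F) gprod treeT absq x z * h z)).
  rewrite mulr_sumr; apply: ler_sum => z _; rewrite normG mulrA ler_pM2r //.
  rewrite mulrC ler_wpM2r //; apply: gprod_ge0 => a b; exact: ltW.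
apply: le_trans (ler_wpM2l Gam_ge0 le1) _.
apply: (@le_trans _ _
  (Gam * (1 + (K ^+ 3 + K ^+ 2 + beta * gam (pi x))) * h x)); last first.
  by rewrite ler_pM2r.
rewrite -[leRHS]mulrA; apply: ler_wpM2l => //.
rewrite -[X in X + _]mul1r -mulrDl ler_pM2r // !lerD2l -[leRHS]mulr1.
apply: ler_wpM2l; first exact: mulr_ge0.
by rewrite ler_pdivrMr // mul1r lerDl.
Qed.

Let schur_term (f : l2) z x := normc (G z x) * (normc (f x) ^+ 2 / h x).

Let schur_term_ge0 f z x : 0 <= schur_term f z x.
Proof.
by apply: mulr_ge0; rewrite ?normc_ge0 // divr_ge0 ?sqr_ge0 // ltW.
Qed.

Let schur_term_summable f z : summableR (schur_term f z).
Proof.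
apply: (summableR_le _ (summableRZ (C / h z) (sqnorm_summable f))) => x.
rewrite !ger0_norm //; last first.
  by rewrite mulr_ge0 ?sqr_ge0 // divr_ge0 // ltW.
have := @schur_row x [:: z] isT; rewrite big_seq1 G_sym.
rewrite -ler_pdivlMr // => le1.
rewrite /schur_term mulrA mulrAC; apply: ler_wpM2r; first exact: sqr_ge0.
rewrite ler_pdivrMr //; apply: le_trans le1 _.
by rewrite mulrAC.
Qed.

Lemma schur_bound (f : l2) z :
  normc (bil (Gl z) f) ^+ 2 <= 4 * C * (h z * psum (schur_term f z)).
Proof.
set S := psum _; have S0 : 0 <= S by exact: psum_ge0.
have hz := ltW (h_gt0 z).
have B0 : 0 <= C * h z * S by apply: mulr_ge0 => //; apply: mulr_ge0.
have le1 : psum (fun x => normc (Gl z x * f x)) <= Num.sqrt (C * h z * S).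
  apply: (@summableR_seq _ _ _ _ _ _).2 => [x|F uF]; first exact: normc_ge0.
  rewrite -(ler_pXn2r (n := 2)) ?nnegrE ?sqrtr_ge0 //; last first.
    by apply: sumr_ge0 => x _; exact: normc_ge0.
  rewrite sqr_sqrtr //; under eq_bigr do rewrite ComplexField.Normc.normcM.
  apply: (le_trans (@schur_cauchy_schwarz _ _ F (fun x => normc (G z x)) h
    (fun x => normc (f x)) _ _ _)) => // [x|x|]; try exact: normc_ge0.
  apply: ler_pM.
  - by apply: sumr_ge0 => x _; rewrite mulr_ge0 ?normc_ge0 // ltW.
  - by apply: sumr_ge0 => x _; exact: schur_term_ge0.
  - exact: schur_row.
  - exact: (seq_le_psum (schur_term_ge0 f z) (schur_term_summable f z) uF).
have := normc_csum_le (bil_summable (Gl z) f); rewrite -/(bil _ _) => le2.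
apply: (@le_trans _ _ ((2 * Num.sqrt (C * h z * S)) ^+ 2)).
  rewrite ler_pXn2r ?nnegrE ?normc_ge0 ?mulr_ge0 ?sqrtr_ge0 //.
  by apply: le_trans le2 _; rewrite ler_pM2l.
rewrite exprMn sqr_sqrtr // le_eqVlt; apply/orP; left; apply/eqP; ring.
Qed.

(** After exchanging the two sums, symmetry of [G] lets the row bound [schur_row] serve for the
    columns too. *)
Lemma green_bounded (f : l2) (F : seq VT) : uniq F ->
  \sum_(z <- F) normc (bil (Gl z) f) ^+ 2 <= (2 * C * l2norm f) ^+ 2.
Proof.
move=> uF; apply: (@le_trans _ _ (4 * C * \sum_(z <- F) h z * psum (schur_term f z))).
  by rewrite mulr_sumr; apply: ler_sum => z _; exact: schur_bound.
have -> : (2 * C * l2norm f) ^+ 2 = 4 * C * (C * l2norm f ^+ 2) by ring.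
apply: ler_wpM2l; first exact: mulr_ge0.
rewrite (eq_bigr (fun z => psum (fun x => h z * schur_term f z x))); last first.
  by move=> z _; rewrite psumZ // ltW.
have [ |z| _ <-] := psum_sum F predT (u := fun z x => h z * schur_term f z x).
- by move=> z x; rewrite mulr_ge0 // ltW.
- exact: summableRZ.
rewrite l2norm_sqr -psumZ //; last exact: sqnorm_summable.
  apply: psum_le; last by apply: summableRZ; exact: sqnorm_summable.
    by move=> x; apply: sumr_ge0 => z _; rewrite mulr_ge0 // ltW.
  move=> x; have hx := h_gt0 x.
  rewrite (eq_bigr (fun z => normc (G x z) * h z * (normc (f x) ^+ 2 / h x))); last first.
    by move=> z _; rewrite /schur_term G_sym; ring.
  rewrite -mulr_suml; apply: (@le_trans _ _ (C * h x * (normc (f x) ^+ 2 / h x))).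
    apply: ler_wpM2r; last exact: schur_row.
    by rewrite divr_ge0 ?sqr_ge0 // ltW.
  by rewrite le_eqVlt; apply/orP; left; apply/eqP; field; rewrite gt_eqF.
by move=> x; exact: sqr_ge0.
Qed.

End Schur.

Lemma green_op_bound : exists2 C : R, 0 <= C & forall (f : l2) (F : seq VT),
  uniq F -> \sum_(z <- F) normc (bil (Gl z) f) ^+ 2 <= (C * l2norm f) ^+ 2.
Proof.
have [[[o _] _] _] := cover_tree Hcover.
have om_ge0 a b : 0 <= om a b by exact: le_trans (om_ge1 a b).
have gam_ge0 a : 0 <= gam a by exact: ltW.
have le_sum (I : finType) (F : I -> R) i : (forall j, 0 <= F j) -> F i <= \sum_j F j.
  by move=> F0; rewrite (bigD1 i) //= lerDl; apply: sumr_ge0.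
pose t a b := om a b + normc (rho a b) ^+ 2 * om a b.
have n0 a b : 0 <= normc (rho a b) ^+ 2 * om a b by rewrite mulr_ge0 ?sqr_ge0.
have t0 a b : 0 <= t a b by apply: addr_ge0.
have [K [K1 Kom Ksum]] : exists K : R, [/\ 1 <= K, forall a b, om a b <= K &
    forall a (Q : pred VH), \sum_(b | Q b) normc (rho a b) ^+ 2 * om a b <= K].
  exists (1 + \sum_a \sum_b t a b).
  have row a : \sum_b t a b <= 1 + \sum_a \sum_b t a b.
    apply: le_trans (@le_sum _ (fun a => \sum_b t a b) a _) _.
      by move=> i; apply: sumr_ge0.
    by rewrite lerDr.
  split=> [|a b|a Q].
  - by rewrite lerDl; apply: sumr_ge0 => a _; apply: sumr_ge0.
  - apply: le_trans (row a); apply: le_trans (@le_sum _ (t a) b (t0 a)).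
    by rewrite lerDl.
  - apply: le_trans (row a); rewrite big_mkcond; apply: ler_sum => b _.
    by case: ifP => _ //; rewrite lerDr.
have [Gam Gam0 Gaminv] : exists2 Gam : R, 0 <= Gam & forall a, (gam a)^-1 <= Gam.
  exists (\sum_a (gam a)^-1); first by apply: sumr_ge0 => a _; rewrite invr_ge0.
  by move=> a; apply: (@le_sum _ (fun a => (gam a)^-1)) => i; rewrite invr_ge0.
have K0 : 0 <= K by exact: le_trans K1.
have K10 : 0 < K + 1 by apply: ltr_wpDl.
pose D := 1 + (K ^+ 3 + K ^+ 2).
have D0 : 0 <= D by rewrite addr_ge0 // addr_ge0 // exprn_ge0.
(* Chosen so that [beta * gam a / (K + 1)] is [D] times [Gam * gam a], which is at least 1. *)
pose beta := D * (K + 1) * Gam.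
have beta0 : 0 <= beta by apply: mulr_ge0 => //; apply: mulr_ge0 => //; exact: ltW.
have betag a : D <= beta * gam a / (K + 1).
  have -> : beta * gam a / (K + 1) = D * (Gam * gam a).
    by rewrite /beta; field; rewrite gt_eqF.
  apply: ler_peMr => //; rewrite -ler_pdivrMr // div1r; exact: Gaminv.
pose C := Gam * (1 + (K ^+ 3 + K ^+ 2 + beta * \sum_a gam a)).
have Cg a : Gam * (1 + (K ^+ 3 + K ^+ 2 + beta * gam a)) <= C.
  by apply: ler_wpM2l => //; rewrite !lerD2l; apply: ler_wpM2l => //; exact: le_sum.
have C0 : 0 <= C.
  apply: mulr_ge0 => //; rewrite !addr_ge0 ?exprn_ge0 //.
  by apply: mulr_ge0 => //; apply: sumr_ge0.
exists (2 * C); first exact: mulr_ge0.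
move=> f F uF; exact: (green_bounded o K1 Kom Ksum Gam0 Gaminv beta0 betag C0 Cg).
Qed.

Lemma green_of_ratio : exists2 N : {linear l2 -> l2},
  bounded_inverse M N & forall u, green N u u != 0.
Proof.
have [C C0 bound] := green_op_bound.
have NP (f : l2) : (fun z => bil (Gl z) f) \in @l2_pred R VT.
  apply: l2_predP; apply: (@summableR_seq _ _ _ ((C * l2norm f) ^+ 2) _ (bound f)).1.
  by move=> z; exact: sqr_ge0.
pose N0 (f : l2) : l2 := L2 (NP f).
have [N NE] : exists N : {linear l2 -> l2}, forall f, N f = N0 f.
  apply: linear_fun_exists => c f g; apply: l2_ext => z.
  by rewrite l2D l2Z /= ![bil (Gl z) _]bilC bilD bilZ.
have GlE u z : Gl u z = G u z by [].
exists N; last first.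
  move=> u; rewrite /green NE /= bilC bil_delta GlE /G gprod_id.
  by rewrite mul1r invr_eq0.
split=> [|f|f].
- exists C => f.
  rewrite -(ler_pXn2r (n := 2)) ?nnegrE ?l2norm_ge0 ?mulr_ge0 ?l2norm_ge0 //.
  rewrite l2norm_sqr NE; apply: (@summableR_seq _ _ _ _ _ (bound f)).2 => z.
  exact: sqr_ge0.
(* Here [M] moves onto the row [Gl z]; for the other inverse it acts on the index [z], and symmetry
   of [G] reduces that to the same equation. *)
- apply: l2_ext => z; rewrite NE /= (op_symmetric_bil Msym).
  have -> : M (Gl z) = delta z.
    by apply: l2_ext => x; rewrite Mop deltaE -G_apply.
  exact: bil_delta.
- apply: l2_ext => z; rewrite Mop NE /op_apply /=.
  rewrite (eq_bigr (fun b => bil (m (pi z) b *: Gl (clift z b)) f)); last first.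
    by move=> b _; rewrite bilZ.
  rewrite -bil_sum -bilZ -bilD.
  have -> : m (pi z) (pi z) *: Gl z +
      \sum_(b | H (pi z) b) m (pi z) b *: Gl (clift z b) = delta z.
    apply: l2_ext => x; rewrite l2D l2Z l2_sumE deltaE eq_sym -(G_apply x z).
    rewrite /op_apply GlE G_sym; congr (_ + _); apply: eq_bigr => b _.
    by rewrite l2Z GlE G_sym.
  exact: bil_delta.
Qed.

End Backward.

(* The implication from a contracting ratio system to invertibility fails when
   [H] is a tree (for H = K_2, all entries of M equal to 1 and r = -1, M is
   singular and the decay rate is 0), so the equivalence excludes trees; the
   other implication is stated for every [H]. *)
Theorem theorem6p2 (R : realType) (VH : finType) (VT : choiceType)
    (H : sgraph VH) (T : sgraph VT) (pi : VT -> VH)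
    (M : {linear l2 R VT -> l2 R VT}) (m : VH -> VH -> R[i])
    (Hconn : graph_connected H) (Hcover : universal_cover T H pi)
    (Mbounded : bounded_op M) (Msym : op_symmetric M) (Mlocal : op_local T M)
    (Mconn : op_connected T M) (Mpull : pulled_back T pi M m) :
  let green_condition :=
    exists2 N : {linear l2 R VT -> l2 R VT},
      bounded_inverse M N & forall u, green N u u != 0 in
  let ratio_condition :=
    exists2 r : dedge H -> R[i], ratio_system m r & decay_rate r < 1 in
  (green_condition -> ratio_condition) /\
  (~ is_tree H -> (green_condition <-> ratio_condition)).
Proof.
move=> green_condition ratio_condition.
have fwd : green_condition -> ratio_condition.
  move=> [N [_ MK NK] green_neq0].
  exact: (ratio_of_green Hconn Hcover Msym Mlocal Mconn Mpull MK NK green_neq0).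
split=> // ntree; split=> // -[r rs /decay_weight_exists[w w_eq]].
apply: (green_of_ratio Hconn Hcover Msym Mlocal Mconn Mpull _ rs w_eq).
by move=> acyc; apply: ntree.
Qed.
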